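(* Let $n\ge1$. There exists a superalgebra isomorphism $$\widehat\Phi:\ \mathfrak H^{\mathfrak c}\xrightarrow{\ \cong\ }\mathcal C_n\otimes\mathfrak H^-,\qquad c_i\mapsto c_i,\quad a_i\mapsto\sqrt{-2}\,c_ib_i,\quad s_i\mapsto\frac1{\sqrt{-2}}(c_i-c_{i+1})t_i,$$ and its inverse $\widehat\Psi$ is given by $$c_i\mapsto c_i,\quad b_i\mapsto\frac1{\sqrt{-2}}c_ia_i,\quad t_i\mapsto\frac1{\sqrt{-2}}(c_{i+1}-c_i)s_i.$$
   Context: $\sqrt{-2}$ is a fixed square root of $-2$ in $\mathbb C$. $S_n$ is the symmetric group with simple transpositions $s_i=(i,i+1)$. $\mathcal C_n$ is the Clifford algebra over $\mathbb C$ generated by odd elements $c_1,\dots,c_n$ with $c_i^2=1$, $c_ic_j=-c_jc_i$ ($i\ne j$). The degenerate affine Hecke-Clifford algebra $\mathfrak H^{\mathfrak c}$ is the $\mathbb C$-algebra generated by $a_i,c_i$ ($1\le i\le n$) and $S_n$ (with the relations of the group $S_n$), subject to: $\sigma c_i=c_{\sigma(i)}\sigma$ ($\sigma\in S_n$), $c_i^2=1$, $c_ic_j=-c_jc_i$ ($i\ne j$), $a_js_i=s_ia_j$ ($j\ne i,i+1$), $a_{i+1}s_i-s_ia_i=1-c_{i+1}c_i$, $c_ia_i=-a_ic_i$, $a_ia_j=a_ja_i$ (all $i,j$), $c_ja_i=a_ic_j$ ($i\neq j$). It is a superalgebra ($\mathbb Z_2$-graded algebra) with $c_i$ odd and $a_i$,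 $s_i$ even. The degenerate spin affine Hecke algebra $\mathfrak H^-$ is the $\mathbb C$-algebra generated by $b_i$ ($1\le i\le n$) and $t_i$ ($1\le i\le n-1$), subject to: $t_i^2=1$, $t_it_{i+1}t_i=t_{i+1}t_it_{i+1}$, $t_it_j=-t_jt_i$ ($|i-j|>1$), $b_ib_j=-b_jb_i$ ($i\ne j$), $b_{i+1}t_i=-t_ib_i+1$, $t_jb_i=-b_it_j$ ($i\ne j,j+1$). It is a superalgebra with all $b_i$ and $t_i$ odd. The tensor product of superalgebras has multiplication $(c'\otimes b')(c\otimes b)=(-1)^{|b'||c|}(c'c\otimes b'b)$ for homogeneous $b',c$; one writes $cb$ for $c\otimes b$, $c=c\otimes1$, $b=1\otimes b$. *)

(* Defs.v *)
From HB Require Import structures.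
From mathcomp Require Import all_boot all_order all_algebra all_fingroup.
From mathcomp Require Import generic_quotient ring_quotient.
From mathcomp Require Import boolp reals.
From mathcomp Require Import complex.
From mathcomp Require Import finmap monalg.

Set Implicit Arguments.
Unset Strict Implicit.
Unset Printing Implicit Defensive.

Import GRing.Theory.
Local Open Scope ring_scope.

(* Superalgebras.  MathComp's algType requires 1 != 0, which is not known a   *)
(* priori for an algebra given by generators and relations, and its hierarchy *)
(* leaves no room for a module that is also a possibly zero ring.  Hence a    *)
(* K-algebra is here a pzRingType with a central ring morphism salgC from K.  *)
(* The Z/2-grading is given by its two projections, hpart false onto the even *)
(* part and hpart true onto the odd part.                                     *)

HB.mixin Record isSuperalgebra (K : fieldType) A of GRing.PzRing A := {
  salgC : K -> A;
  salgC_zmod_morphism : zmod_morphism salgC;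
  salgC_monoid_morphism : monoid_morphism salgC;
  salgC_central : forall k x, salgC k * x = x * salgC k;
  hpart : bool -> A -> A;
  hpart_zmod_morphism : forall b, zmod_morphism (hpart b);
  hpartZ : forall b k x, hpart b (salgC k * x) = salgC k * hpart b x;
  hpartK : forall a b x, hpart a (hpart b x) = if a == b then hpart b x else 0;
  hpart_sum : forall x, hpart false x + hpart true x = x;
  hpart1 : hpart false 1 = 1;
  hpartM : forall a b x y, hpart a x = x -> hpart b y = y ->
    hpart (a (+) b) (x * y) = x * y
}.

#[short(type="superalgType")]
HB.structure Definition Superalgebra (K : fieldType) :=
  { A of GRing.PzRing A & isSuperalgebra K A }.

Definition homogeneous (K : fieldType) (A : superalgType K) (b : bool) (x : A) :=
  hpart b x = x.

Definition sscale (K : fieldType) (A : superalgType K) (k : K) (x : A) : A :=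
  salgC k * x.
Notation "k ∙ x" := (sscale k x) (at level 40, left associativity) : ring_scope.

Definition superalg_hom (K : fieldType) (A B : superalgType K) (f : A -> B) :=
  [/\ zmod_morphism f, monoid_morphism f, forall k x, f (k ∙ x) = k ∙ f x &
      forall b x, homogeneous b x -> homogeneous b (f x)].

Section SuperalgebraTheory.
Variables (K : fieldType) (A : superalgType K).
Implicit Types (x y : A) (k : K).

HB.instance Definition _ :=
  GRing.isZmodMorphism.Build K A (@salgC K A) salgC_zmod_morphism.
HB.instance Definition _ :=
  GRing.isMonoidMorphism.Build K A (@salgC K A) salgC_monoid_morphism.
HB.instance Definition _ b :=
  GRing.isZmodMorphism.Build A A (@hpart K A b) (hpart_zmod_morphism b).

Lemma sscaleAl k x y : k ∙ (x * y) = (k ∙ x) * y.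
Proof. by rewrite /sscale mulrA. Qed.

Lemma sscaleAr k x y : k ∙ (x * y) = x * (k ∙ y).
Proof. by rewrite /sscale !mulrA salgC_central. Qed.

Lemma sscaleDr k x y : k ∙ (x + y) = k ∙ x + k ∙ y.
Proof. exact: mulrDr. Qed.

Lemma sscaleDl k l x : (k + l) ∙ x = k ∙ x + l ∙ x.
Proof. by rewrite /sscale rmorphD mulrDl. Qed.

Lemma sscaleA k l x : k ∙ (l ∙ x) = (k * l) ∙ x.
Proof. by rewrite /sscale rmorphM mulrA. Qed.

Lemma sscale1 x : 1 ∙ x = x.
Proof. by rewrite /sscale rmorph1 mul1r. Qed.

Lemma homogeneous_hpart b x : homogeneous b (hpart b x).
Proof. by rewrite /homogeneous hpartK eqxx. Qed.

Lemma homogeneous1 : homogeneous false (1 : A).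
Proof. exact: hpart1. Qed.

Lemma homogeneousM a b x y :
  homogeneous a x -> homogeneous b y -> homogeneous (a (+) b) (x * y).
Proof. exact: hpartM. Qed.

Lemma hpart_homogeneous a b x :
  homogeneous b x -> hpart a x = if a == b then x else 0.
Proof. by rewrite /homogeneous => h; rewrite -{1}h hpartK h. Qed.

Lemma hpart_sumE x : x = \sum_(b : bool) hpart b x.
Proof. by rewrite big_bool /= addrC hpart_sum. Qed.

End SuperalgebraTheory.

(* The constructions below are locked: unification must not unfold them. *)
Fact construction_key : unit. Proof. exact: tt. Qed.

(* Linear extension of a function given on a basis. *)
Section MalgExtension.
Variables (K : fieldType) (I : choiceType).

Definition mext (V : lmodType K) (g : I -> V) : {malg K[I]} -> V :=
  locked_with construction_key (fun u => \sum_(i <- msupp u) u@_i *: g i).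

Lemma mextEw (V : lmodType K) (g : I -> V) (d : {fset I}) u :
  (msupp u `<=` d)%fset -> mext g u = \sum_(i <- d) u@_i *: g i.
Proof.
rewrite /mext locked_withE => le.
rewrite [LHS](big_fset_incl _ le) => //= x xd /mcoeff_outdom ->.
by rewrite scale0r.
Qed.

Lemma mext_linear (V : lmodType K) (g : I -> V) : linear (mext g).
Proof.
move=> k u v.
have h1 := fsubsetUl (msupp u) (msupp v).
have h2 := fsubsetUr (msupp u) (msupp v).
have h3 : (msupp (k *: u + v) `<=` msupp u `|` msupp v)%fset.
  apply: fsubset_trans (msuppD_le _ _) _; apply: fsetSU; exact: msuppZ_le.
rewrite (mextEw _ h1) (mextEw _ h2) (mextEw _ h3) scaler_sumr -big_split /=.
by apply: eq_bigr => i _; rewrite mcoeffD mcoeffZ scalerDl scalerA.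
Qed.

HB.instance Definition _ (V : lmodType K) (g : I -> V) :=
  GRing.isLinear.Build K {malg K[I]} V *:%R (mext g) (mext_linear g).

Lemma mextU (V : lmodType K) (g : I -> V) i : mext g << i >> = g i.
Proof. by rewrite (mextEw _ msuppU_le) big_seq_fset1 mcoeffUU scale1r. Qed.

Lemma malgUZ (k : K) (i : I) : << k *g i >> = k *: << i >> :> {malg K[I]}.
Proof. by apply/malgP => j; rewrite mcoeffZ !mcoeffU mulrnAr mulr1. Qed.

Lemma malg_lin_ind (P : {malg K[I]} -> Prop) :
  P 0 -> (forall k u v, P u -> P v -> P (k *: u + v)) ->
  (forall i, P << i >>) -> forall u, P u.
Proof.
move=> P0 PD PU u; rewrite [u]monalgE.
elim/big_ind: _ => // [x y Px Py|i _]; first by rewrite -[x]scale1r; apply: PD.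
by rewrite malgUZ -[_ *: _]addr0; apply: PD.
Qed.

Lemma malg_lin_ext (V : lmodType K) (f g : {malg K[I]} -> V) :
  linear f -> linear g -> (forall i, f << i >> = g << i >>) -> f =1 g.
Proof.
move=> lf lg h; apply: malg_lin_ind => [|k u v eu ev|//]; last first.
  by rewrite lf lg eu ev.
pose F := GRing.isLinear.Build _ _ _ _ f lf.
pose G := GRing.isLinear.Build _ _ _ _ g lg.
pose f' : {linear {malg K[I]} -> V} := HB.pack f F.
pose g' : {linear {malg K[I]} -> V} := HB.pack g G.
by rewrite -[f]/(f' : _ -> _) -[g]/(g' : _ -> _) !linear0.
Qed.

End MalgExtension.

(* Quotient of a vector space by the span of a set of vectors. *)
Section LinearQuotient.
Variables (K : fieldType) (V : lmodType K) (P : V -> Prop).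

Inductive span : V -> Prop :=
| span0 : span 0
| spanZD k u v of P u & span v : span (k *: u + v).

Lemma span_gen u : P u -> span u.
Proof. by move=> Pu; rewrite -[u]addr0 -[u]scale1r; apply: spanZD => //; exact: span0. Qed.

Lemma spanD u v : span u -> span v -> span (u + v).
Proof.
by elim=> [|k x y Px _ IH] sv; rewrite ?add0r // -addrA; apply: spanZD => //; apply: IH.
Qed.

Lemma spanZ k u : span u -> span (k *: u).
Proof.
elim=> [|l x y Px _ IH]; first by rewrite scaler0; exact: span0.
by rewrite scalerDr scalerA; apply: spanZD.
Qed.

Lemma span_lin (W : lmodType K) (f : {linear V -> W}) (Q : W -> Prop) :
  Q 0 -> (forall x y, Q x -> Q y -> Q (x + y)) ->
  (forall k x, P x -> Q (k *: f x)) -> forall u, span u -> Q (f u).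
Proof.
move=> Q0 QD QP u; elim=> [|k x y Px _ IH]; first by rewrite linear0.
by rewrite linearP; apply: QD => //; apply: QP.
Qed.

Definition span_pred : {pred V} := fun v => `[< span v >].

Lemma span_predP v : reflect (span v) (v \in span_pred).
Proof. exact: asboolP. Qed.

Lemma span_zmod_closed : zmod_closed span_pred.
Proof.
split=> [|u v /span_predP su /span_predP sv]; apply/span_predP; first exact: span0.
by rewrite -scaleN1r; apply: spanD => //; apply: spanZ.
Qed.

HB.instance Definition _ := GRing.isZmodClosed.Build V span_pred span_zmod_closed.

Definition lquot := Quotient.quot span_pred.
HB.instance Definition _ := GRing.Zmodule.on lquot.

Definition lpi : V -> lquot :=
  locked_with construction_key (fun v => (\pi_lquot v)%qT).
Definition lrepr : lquot -> V :=
  locked_with construction_key (fun x => repr x).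

Lemma lreprK x : lpi (lrepr x) = x.
Proof. by rewrite /lpi /lrepr !locked_withE reprK. Qed.

Lemma lpiB u v : lpi (u - v) = lpi u - lpi v.
Proof. by rewrite /lpi !locked_withE !piE. Qed.

Lemma lpiP u v : lpi u = lpi v <-> span (u - v).
Proof.
split=> [/eqP|h].
  by rewrite /lpi !locked_withE -Quotient.idealrBE => /span_predP.
by apply/eqP; rewrite /lpi !locked_withE -Quotient.idealrBE; apply/span_predP.
Qed.

Definition lquot_scale (k : K) (x : lquot) : lquot := lpi (k *: lrepr x).

Lemma lquot_scaleE k u : lquot_scale k (lpi u) = lpi (k *: u).
Proof.
apply/lpiP; rewrite -scalerBr; apply: spanZ.
by apply/lpiP; rewrite lreprK.
Qed.

Lemma lpiD u v : lpi (u + v) = lpi u + lpi v.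
Proof. by rewrite /lpi !locked_withE !piE. Qed.

Fact lquot_scaleA a b x :
  lquot_scale a (lquot_scale b x) = lquot_scale (a * b) x.
Proof. by rewrite -[x]lreprK !lquot_scaleE scalerA. Qed.
Fact lquot_scale1 : left_id 1 lquot_scale.
Proof. by move=> x; rewrite -[x]lreprK lquot_scaleE scale1r. Qed.
Fact lquot_scaleDr : right_distributive lquot_scale +%R.
Proof.
move=> a x y; rewrite -[x]lreprK -[y]lreprK -lpiD !lquot_scaleE -lpiD.
by rewrite scalerDr.
Qed.
Fact lquot_scaleDl x : {morph lquot_scale^~ x : a b / a + b}.
Proof. by move=> a b; rewrite -[x]lreprK !lquot_scaleE -lpiD scalerDl. Qed.

HB.instance Definition _ := GRing.Zmodule_isLmodule.Build K lquot
  lquot_scaleA lquot_scale1 lquot_scaleDr lquot_scaleDl.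

Lemma lpi_linear : linear lpi.
Proof. by move=> k u v; rewrite lpiD -lquot_scaleE. Qed.

HB.instance Definition _ :=
  GRing.isLinear.Build K V lquot *:%R lpi lpi_linear.

Lemma lpi_gen u : P u -> lpi u = 0.
Proof. by move=> Pu; rewrite -(linear0 lpi); apply/lpiP; rewrite subr0; exact: span_gen. Qed.

Lemma lquot_lift (W : lmodType K) (f : {linear V -> W}) :
  (forall u, P u -> f u = 0) -> forall u, f (lrepr (lpi u)) = f u.
Proof.
move=> fP u; apply/eqP; rewrite -subr_eq0 -linearB; apply/eqP.
apply: (@span_lin _ f (fun w => w = 0)) => // [x y -> ->|k x Px|].
- by rewrite addr0.
- by rewrite fP // scaler0.
- by apply/lpiP; rewrite lreprK.
Qed.

End LinearQuotient.

(* Free algebras, graded by the number of odd letters modulo 2. *)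
Section FreeSuperalgebra.
Variables (K : fieldType) (G : choiceType) (par : G -> bool).

Definition freealg := {malg K[{fmonom G}]}.
HB.instance Definition _ := GRing.Lalgebra.on freealg.

Definition fgen (g : G) : freealg := << fmu g >>.

Definition wpar (m : {fmonom G}) : bool := \big[addb/false]_(g <- m) par g.

Definition fpart (b : bool) : freealg -> freealg :=
  mext (fun m => if wpar m == b then << m >> else 0 : freealg).

HB.instance Definition _ b := GRing.Linear.on (fpart b).

Lemma fpartU b m : fpart b << m >> = if wpar m == b then << m >> else 0.
Proof. exact: mextU. Qed.

Lemma wparM (m1 m2 : {fmonom G}) : wpar (mmul m1 m2) = wpar m1 (+) wpar m2.
Proof. by rewrite /wpar fmM big_cat. Qed.

Lemma wpar1 : wpar mone = false.
Proof. by rewrite /wpar fm1 big_nil. Qed.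

Lemma freeUM (m1 m2 : {fmonom G}) : << m1 >> * << m2 >> = << mmul m1 m2 >> :> freealg.
Proof. by rewrite malgM_def fgmulUU mulr1. Qed.

Lemma fpart_gen b g : fpart b (fgen g) = if par g == b then fgen g else 0.
Proof. by rewrite /fgen fpartU /wpar fmU big_seq1. Qed.

Lemma fpart1 b : fpart b 1 = if b then 0 else 1.
Proof. by rewrite fpartU wpar1; case: b. Qed.

Lemma free_malgC_comm (k : K) (u : freealg) : k%:MP * u = u * k%:MP.
Proof.
move: u; apply: malg_lin_ind => [|l u w hu hw|m]; first by rewrite mulr0 mul0r.
  by rewrite mulrDr mulrDl hw -scalerAl -hu !mul_malgC !scalerA mulrC.
by rewrite !malgM_def !fgmulUU mul1m mulm1 mulr1 mul1r.
Qed.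

Lemma free_scalerAr (k : K) (u v : freealg) : k *: (u * v) = u * (k *: v).
Proof. by rewrite -[k *: v]mul_malgC mulrA -free_malgC_comm -mulrA mul_malgC. Qed.

Lemma fpartM d u v :
  fpart d (u * v) = \sum_(a : bool) fpart a u * fpart (d (+) a) v.
Proof.
move: u; apply: malg_lin_ind => [|l u w hu hw|m].
- by rewrite mul0r linear0 big1 // => a _; rewrite linear0 mul0r.
- rewrite mulrDl -scalerAl linearP /= hu hw scaler_sumr -big_split /=.
  by apply: eq_bigr => a _; rewrite linearP /= mulrDl -scalerAl.
move: v; apply: malg_lin_ind => [|l u w hu hw|m'].
- by rewrite mulr0 linear0 big1 // => a _; rewrite linear0 mulr0.
- rewrite mulrDr -free_scalerAr linearP /= hu hw scaler_sumr -big_split /=.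
  by apply: eq_bigr => a _; rewrite linearP /= mulrDr -free_scalerAr.
rewrite freeUM fpartU wparM big_bool /= !fpartU.
by case: (wpar m); case: (wpar m'); case: d;
   rewrite ?(mulr0, mul0r, add0r, addr0, freeUM).
Qed.

Lemma fpartK a b u : fpart a (fpart b u) = if a == b then fpart b u else 0.
Proof.
move: u; apply: malg_lin_ind => [|l u w hu hw|m].
- by rewrite !linear0 if_same.
- by rewrite !linearP /= hu hw; case: eqP => // _; rewrite scaler0 addr0.
- rewrite fpartU; case: (wpar m =P b) => [<-|_].
    by rewrite fpartU eq_sym.
  by rewrite linear0 if_same.
Qed.

Lemma fpart_sum u : fpart false u + fpart true u = u.
Proof.
move: u; apply: malg_lin_ind => [|l u w hu hw|m].
- by rewrite !linear0 addr0.
- by rewrite !linearP /= addrACA -scalerDr hu hw.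
- by rewrite !fpartU; case: (wpar m); rewrite /= ?add0r ?addr0.
Qed.

Lemma fhom_gen g : fpart (par g) (fgen g) = fgen g.
Proof. by rewrite fpart_gen eqxx. Qed.

Lemma fhom1 : fpart false 1 = 1.
Proof. by rewrite fpart1. Qed.

Lemma fhomN b u : fpart b u = u -> fpart b (- u) = - u.
Proof. by move=> hu; rewrite linearN /= hu. Qed.

Lemma fhomD b u v : fpart b u = u -> fpart b v = v -> fpart b (u + v) = u + v.
Proof. by move=> hu hv; rewrite linearD /= hu hv. Qed.

Lemma fhomM a b u v :
  fpart a u = u -> fpart b v = v -> fpart (a (+) b) (u * v) = u * v.
Proof.
move=> hu hv; rewrite fpartM -hu -hv.
under eq_bigr => c _ do rewrite !fpartK.
rewrite hu hv big_bool /=.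
by case: (a) (b) => [] []; rewrite /= ?(mul0r, mulr0, add0r, addr0).
Qed.

End FreeSuperalgebra.

(* Superalgebras presented by generators with given parities and relations    *)
(* lhs = rhs between elements of the free algebra that are homogeneous of the *)
(* same degree: the quotient of the free algebra by the span of all products  *)
(* u * (lhs - rhs) * v, that is, by the two-sided ideal generated by the      *)
(* relations.                                                                 *)

Record presentation (K : fieldType) := Presentation {
  pgen : choiceType;
  ppar : pgen -> bool;
  prel : freealg K pgen -> freealg K pgen -> Prop;
  prel_homogeneous : forall l r, prel l r ->
    exists b, fpart ppar b l = l /\ fpart ppar b r = r
}.

Section PresentedSuperalgebra.
Variables (K : fieldType) (p : presentation K).
Local Notation F := (freealg K (pgen p)).
Local Notation fpart := (fpart (@ppar K p)).

Inductive ideal_gen : F -> Prop :=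
| IdealGen u l r v of prel l r : ideal_gen (u * (l - r) * v).

Definition presalg := lquot ideal_gen.
HB.instance Definition _ := GRing.Zmodule.on presalg.

Local Notation pi := (lpi ideal_gen : F -> presalg).
Local Notation rp := (@lrepr K _ ideal_gen : presalg -> F).

Definition presalg_gen (g : pgen p) : presalg := pi (fgen K g).
Definition presalg_mul : presalg -> presalg -> presalg :=
  locked_with construction_key (fun x y => pi (rp x * rp y)).

Lemma ideal_mull u v : span ideal_gen v -> span ideal_gen (u * v).
Proof.
elim=> [|k x y [w l r z rlr] _ IH]; first by rewrite mulr0; exact: span0.
rewrite mulrDr -free_scalerAr; apply: spanZD => //.
by rewrite !mulrA; exact: IdealGen.
Qed.

Lemma ideal_mulr u v : span ideal_gen v -> span ideal_gen (v * u).
Proof.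
elim=> [|k x y [w l r z rlr] _ IH]; first by rewrite mul0r; exact: span0.
rewrite mulrDl -scalerAl; apply: spanZD => //.
by rewrite -(mulrA _ z u); exact: IdealGen.
Qed.

Lemma presalg_mulE u v : presalg_mul (pi u) (pi v) = pi (u * v).
Proof.
have h (w : F) : span ideal_gen (rp (pi w) - w) by apply/lpiP; rewrite lreprK.
rewrite /presalg_mul locked_withE; apply/lpiP.
have -> : rp (pi u) * rp (pi v) - u * v
        = (rp (pi u) - u) * rp (pi v) + u * (rp (pi v) - v).
  by rewrite mulrBl mulrBr addrA subrK.
by apply: spanD; [apply: ideal_mulr | apply: ideal_mull].
Qed.

Let repK (x : presalg) : x = pi (rp x). Proof. by rewrite lreprK. Qed.
Let piD (u v : F) : pi (u + v) = pi u + pi v. Proof. exact: lpiD. Qed.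

Fact presalg_mulA : associative presalg_mul.
Proof.
by move=> x y z; rewrite (repK x) (repK y) (repK z) !presalg_mulE mulrA.
Qed.
Fact presalg_mul1l : left_id (pi 1) presalg_mul.
Proof. by move=> x; rewrite (repK x) presalg_mulE mul1r. Qed.
Fact presalg_mul1r : right_id (pi 1) presalg_mul.
Proof. by move=> x; rewrite (repK x) presalg_mulE mulr1. Qed.
Fact presalg_mulDl : left_distributive presalg_mul +%R.
Proof.
by move=> x y z; rewrite (repK x) (repK y) (repK z) -piD !presalg_mulE -piD mulrDl.
Qed.
Fact presalg_mulDr : right_distributive presalg_mul +%R.
Proof.
by move=> x y z; rewrite (repK x) (repK y) (repK z) -piD !presalg_mulE -piD mulrDr.
Qed.

HB.instance Definition _ := GRing.Zmodule_isPzRing.Build presalg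
  presalg_mulA presalg_mul1l presalg_mul1r presalg_mulDl presalg_mulDr.

Lemma presalg_piM u v : pi (u * v) = pi u * pi v.
Proof. by rewrite -presalg_mulE. Qed.

Definition presalg_C (k : K) : presalg := pi k%:A.

Fact presalg_C_zmod_morphism : zmod_morphism presalg_C.
Proof. by move=> k l; rewrite /presalg_C scalerBl lpiB. Qed.
Fact presalg_C_monoid_morphism : monoid_morphism presalg_C.
Proof.
split=> [|k l]; first by rewrite /presalg_C scale1r.
by rewrite -presalg_piM -scalerAl mul1r scalerA.
Qed.
Fact presalg_C_pi k u : presalg_C k * pi u = pi (k *: u).
Proof. by rewrite -presalg_piM -scalerAl mul1r. Qed.
Fact presalg_C_central k x : presalg_C k * x = x * presalg_C k.
Proof.
by rewrite (repK x) presalg_C_pi -presalg_piM -free_scalerAr mulr1.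
Qed.

Definition presalg_part (b : bool) : presalg -> presalg :=
  locked_with construction_key (fun x => pi (fpart b (rp x))).

Lemma presalg_partE b u : presalg_part b (pi u) = pi (fpart b u).
Proof.
rewrite /presalg_part locked_withE.
pose f : {linear F -> lquot ideal_gen} := (@lpi K _ ideal_gen) \o fpart b.
apply: (@lquot_lift K F ideal_gen _ f) => _ [w l r z rlr] {u}.
have hr a : lpi ideal_gen (fpart a (l - r)) = 0.
  have [c [hl hr]] := prel_homogeneous rlr.
  have -> : fpart a (l - r) = if a == c then l - r else 0.
    by rewrite linearB /= -hl -hr !fpartK; case: eqP => // _; rewrite subr0.
  case: eqP => _; last exact: linear0.
  by apply: lpi_gen; rewrite -[l - r]mul1r -[_ * _]mulr1; exact: IdealGen.
rewrite /f /= -mulrA fpartM linear_sum big1 //= => a _.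
rewrite fpartM mulr_sumr linear_sum big1 //= => c _.
have := hr (b (+) a (+) c).
move: (hr c); move: (fpart c (l - r)) => e e0 _.
have := @ideal_mulr (fpart (b (+) a (+) c) z) e.
have := (@lpiP _ _ ideal_gen e 0).1; rewrite subr0 linear0 => /(_ e0) se /(_ se) sez.
have := ideal_mull (fpart a w) sez => sw.
by rewrite -(linear0 (lpi ideal_gen)); apply/lpiP; rewrite subr0.
Qed.

Fact presalg_part_zmod_morphism b : zmod_morphism (presalg_part b).
Proof.
move=> x y; rewrite (repK x) (repK y).
by rewrite -[_ - _](lpiB ideal_gen) !presalg_partE linearB lpiB.
Qed.
Fact presalg_partZ b k x :
  presalg_part b (presalg_C k * x) = presalg_C k * presalg_part b x.
Proof. by rewrite (repK x) presalg_C_pi !presalg_partE presalg_C_pi linearZ. Qed.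
Fact presalg_partK a b x :
  presalg_part a (presalg_part b x) = if a == b then presalg_part b x else 0.
Proof.
rewrite (repK x) !presalg_partE fpartK; case: eqP => // _.
exact: linear0.
Qed.
Fact presalg_part_sum x : presalg_part false x + presalg_part true x = x.
Proof. by rewrite (repK x) !presalg_partE -piD fpart_sum. Qed.
Fact presalg_part1 : presalg_part false 1 = 1.
Proof. by rewrite presalg_partE fpart1. Qed.
Fact presalg_partM a b x y : presalg_part a x = x -> presalg_part b y = y ->
  presalg_part (a (+) b) (x * y) = x * y.
Proof.
have h c z : presalg_part c z = z -> exists2 u, z = pi u & fpart c u = u.
  by move=> hz; exists (fpart c (rp z)); rewrite ?fpartK ?eqxx //
    -{1}hz {1}(repK z) presalg_partE.
move=> /h[u -> hu] /h[v -> hv].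
by rewrite -presalg_piM presalg_partE fhomM.
Qed.

HB.instance Definition _ := isSuperalgebra.Build K presalg
  presalg_C_zmod_morphism presalg_C_monoid_morphism presalg_C_central
  presalg_part_zmod_morphism presalg_partZ presalg_partK presalg_part_sum
  presalg_part1 presalg_partM.

End PresentedSuperalgebra.

(* Tensor product of superalgebras: the vector space A ⊗ B is the free one on *)
(* A * B modulo bilinearity.                                                  *)
Section TensorProduct.
Variables (K : fieldType) (A B : superalgType K).
Local Notation F := {malg K[(A * B)%type]}.

Inductive bilinear_gen : F -> Prop :=
| BilDl x x' y :
    bilinear_gen (<< (x + x', y) >> - (<< (x, y) >> + << (x', y) >>))
| BilDr x y y' :
    bilinear_gen (<< (x, y + y') >> - (<< (x, y) >> + << (x, y') >>))
| BilZl k x y : bilinear_gen (<< (k ∙ x, y) >> - k *: << (x, y) >>)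
| BilZr k x y : bilinear_gen (<< (x, k ∙ y) >> - k *: << (x, y) >>).

Definition tensor := lquot bilinear_gen.
HB.instance Definition _ := GRing.Lmodule.on tensor.

Definition tens : A -> B -> tensor :=
  locked_with construction_key (fun x y => lpi bilinear_gen << (x, y) >>).
Fact tensE x y : tens x y = lpi bilinear_gen << (x, y) >>.
Proof. by rewrite /tens locked_withE. Qed.
Local Notation "x ⊗ y" := (tens x y) (at level 40, left associativity).

Definition bilinear_map (V : lmodType K) (g : A -> B -> V) : Prop :=
  [/\ forall x x' y, g (x + x') y = g x y + g x' y,
      forall x y y', g x (y + y') = g x y + g x y',
      forall k x y, g (k ∙ x) y = k *: g x y &
      forall k x y, g x (k ∙ y) = k *: g x y].

Definition tlift (V : lmodType K) (g : A -> B -> V) : tensor -> V :=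
  locked_with construction_key (fun t => mext (fun p => g p.1 p.2) (lrepr t)).

Lemma tens_bilinear : bilinear_map tens.
Proof.
have h u v : bilinear_gen (u - v) ->
    lpi bilinear_gen u = lpi bilinear_gen v.
  by move=> /lpi_gen; rewrite lpiB => /eqP; rewrite subr_eq0 => /eqP.
split=> [x x' y|x y y'|k x y|k x y].
- by rewrite !tensE -lpiD; apply/h/BilDl.
- by rewrite !tensE -lpiD; apply/h/BilDr.
- by rewrite !tensE -linearZ; apply/h/BilZl.
- by rewrite !tensE -linearZ; apply/h/BilZr.
Qed.

Lemma tensDl x x' y : (x + x') ⊗ y = x ⊗ y + x' ⊗ y.
Proof. by case: tens_bilinear. Qed.
Lemma tensDr x y y' : x ⊗ (y + y') = x ⊗ y + x ⊗ y'.
Proof. by case: tens_bilinear. Qed.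
Lemma tensZl k x y : (k ∙ x) ⊗ y = k *: (x ⊗ y).
Proof. by case: tens_bilinear. Qed.
Lemma tensZr k x y : x ⊗ (k ∙ y) = k *: (x ⊗ y).
Proof. by case: tens_bilinear. Qed.
Lemma tens0l y : 0 ⊗ y = 0.
Proof. by apply: (addrI (0 ⊗ y)); rewrite -tensDl !addr0. Qed.
Lemma tens0r x : x ⊗ 0 = 0.
Proof. by apply: (addrI (x ⊗ 0)); rewrite -tensDr !addr0. Qed.

Lemma tlift_pi (V : lmodType K) (g : A -> B -> V) u : bilinear_map g ->
  tlift g (lpi bilinear_gen u) = mext (fun p => g p.1 p.2) u.
Proof.
case=> gDl gDr gZl gZr; rewrite /tlift locked_withE.
apply: (@lquot_lift K F bilinear_gen V (mext (fun p => g p.1 p.2))).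
by move=> _ []; intros; rewrite linearB; apply/eqP; rewrite subr_eq0; apply/eqP;
  rewrite ?linearD ?linearZ /= !mextU /= ?(gDl, gDr, gZl, gZr).
Qed.

Lemma tlift_linear (V : lmodType K) (g : A -> B -> V) :
  bilinear_map g -> linear (tlift g).
Proof.
move=> bg k x y; rewrite -[x]lreprK -[y]lreprK -linearP !tlift_pi //.
exact: linearP.
Qed.

Lemma tlift_tens (V : lmodType K) (g : A -> B -> V) x y :
  bilinear_map g -> tlift g (x ⊗ y) = g x y.
Proof. by move=> bg; rewrite tensE tlift_pi // mextU. Qed.

Lemma tensor_ind (P : tensor -> Prop) :
  (forall t u, P t -> P u -> P (t + u)) ->
  (forall a b x y, homogeneous a x -> homogeneous b y -> P (x ⊗ y)) ->
  forall t, P t.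
Proof.
move=> PD PT t.
have PT' x y : P (x ⊗ y).
  rewrite (hpart_sumE x) (hpart_sumE y) !big_bool /= !tensDl !tensDr.
  by apply: (PD); apply: (PD);
     apply: (PT _ _ _ _ (homogeneous_hpart _ _) (homogeneous_hpart _ _)).
have PTZ k x y : P (k *: (x ⊗ y)) by rewrite -tensZl.
suff h : forall u, (forall k, P (k *: lpi bilinear_gen u)).
  by rewrite -[t]lreprK -[lpi _ _]scale1r.
apply: malg_lin_ind => [k|l u v hu hv k|[x y] k]; last by rewrite -tensE; exact: PTZ.
  by rewrite linear0 scaler0 -(tens0l 0).
by rewrite linearP scalerDr scalerA; apply: PD.
Qed.

Definition tensor_sign (y : bool) (x : bool) : K := (-1) ^+ (y && x).

(* (x ⊗ y)(x' ⊗ y') = (-1)^(|y||x'|) xx' ⊗ yy' for y and x' homogeneous, *)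
(* extended bilinearly.                                                  *)
Definition tens_mul : A -> B -> A -> B -> tensor :=
  locked_with construction_key (fun x y x' y' =>
    \sum_(b : bool) \sum_(a : bool)
      tensor_sign b a *: ((x * hpart a x') ⊗ (hpart b y * y'))).

Definition tensor_mul : tensor -> tensor -> tensor :=
  locked_with construction_key
    (fun t u => tlift (fun x y => tlift (tens_mul x y) u) t).

Definition tensor_part (c : bool) : tensor -> tensor :=
  locked_with construction_key
    (tlift (fun x y => \sum_(a : bool) hpart a x ⊗ hpart (c (+) a) y)).

Fact tens_mul_bilr x y : bilinear_map (tens_mul x y).
Proof.
split=> [x' x'' y'|x' y' y''|k x' y'|k x' y']; rewrite /tens_mul locked_withE;
  rewrite ?scaler_sumr -?big_split /=; apply: eq_bigr => b _;
  rewrite ?scaler_sumr -?big_split /=; apply: eq_bigr => a _.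
- by rewrite raddfD mulrDr tensDl scalerDr.
- by rewrite mulrDr tensDr scalerDr.
- by rewrite /sscale hpartZ -/(sscale _ _) -sscaleAr tensZl !scalerA mulrC.
- by rewrite -sscaleAr tensZr !scalerA mulrC.
Qed.

Fact tens_mul_bill x' y' : bilinear_map (fun x y => tens_mul x y x' y').
Proof.
split=> [x x2 y|x y y2|k x y|k x y]; rewrite /tens_mul locked_withE;
  rewrite ?scaler_sumr -?big_split /=; apply: eq_bigr => b _;
  rewrite ?scaler_sumr -?big_split /=; apply: eq_bigr => a _.
- by rewrite mulrDl tensDl scalerDr.
- by rewrite raddfD mulrDl tensDr scalerDr.
- by rewrite -sscaleAl tensZl !scalerA mulrC.
- by rewrite /sscale hpartZ -/(sscale _ _) -sscaleAl tensZr !scalerA mulrC.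
Qed.

Fact tensor_mul_aux u : bilinear_map (fun x y => tlift (tens_mul x y) u).
Proof.
have ext (f h : tensor -> tensor) :
    {morph f : t v / t + v} -> {morph h : t v / t + v} ->
    (forall x' y', f (x' ⊗ y') = h (x' ⊗ y')) -> f u = h u.
  move=> fD hD e; move: u; apply: tensor_ind => [t v et ev|a b x' y' _ _].
    by rewrite fD hD et ev.
  exact: e.
have LD x y : {morph tlift (tens_mul x y) : t v / t + v}.
  by move=> t v; rewrite -[t]scale1r (tlift_linear (tens_mul_bilr x y)) !scale1r.
have LT x y x' y' : tlift (tens_mul x y) (x' ⊗ y') = tens_mul x y x' y'.
  exact: tlift_tens (tens_mul_bilr x y).
split=> [x x2 y|x y y2|k x y|k x y].
- apply: (ext _ (fun t => tlift (tens_mul x y) t + tlift (tens_mul x2 y) t)).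
  + exact: LD.
  + by move=> t v; cbv beta; rewrite (LD x y t v) (LD x2 y t v) addrACA.
  + by move=> x' y'; rewrite !LT; case: (tens_mul_bill x' y').
- apply: (ext _ (fun t => tlift (tens_mul x y) t + tlift (tens_mul x y2) t)).
  + exact: LD.
  + by move=> t v; cbv beta; rewrite (LD x y t v) (LD x y2 t v) addrACA.
  + by move=> x' y'; rewrite !LT; case: (tens_mul_bill x' y').
- apply: (ext _ (fun t => k *: tlift (tens_mul x y) t)).
  + exact: LD.
  + by move=> t v; cbv beta; rewrite (LD x y t v) scalerDr.
  + by move=> x' y'; rewrite !LT; case: (tens_mul_bill x' y').
- apply: (ext _ (fun t => k *: tlift (tens_mul x y) t)).
  + exact: LD.
  + by move=> t v; cbv beta; rewrite (LD x y t v) scalerDr.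
  + by move=> x' y'; rewrite !LT; case: (tens_mul_bill x' y').
Qed.

Fact tensor_part_aux c :
  bilinear_map (fun x y => \sum_(a : bool) hpart a x ⊗ hpart (c (+) a) y).
Proof.
split=> [x x' y|x y y'|k x y|k x y];
  rewrite ?scaler_sumr -?big_split /=; apply: eq_bigr => a _.
- by rewrite raddfD tensDl.
- by rewrite raddfD tensDr.
- by rewrite /sscale hpartZ -/(sscale _ _) tensZl.
- by rewrite /sscale hpartZ -/(sscale _ _) tensZr.
Qed.

Fact tensor_mul_tens x y x' y' :
  tensor_mul (x ⊗ y) (x' ⊗ y') = tens_mul x y x' y'.
Proof.
rewrite /tensor_mul locked_withE (tlift_tens _ _ (tensor_mul_aux _)).
exact: tlift_tens (tens_mul_bilr x y).
Qed.

Fact tensor_mul_homog b a x y x' y' : homogeneous b y -> homogeneous a x' ->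
  tensor_mul (x ⊗ y) (x' ⊗ y') = tensor_sign b a *: ((x * x') ⊗ (y * y')).
Proof.
move=> hy hx; rewrite tensor_mul_tens /tens_mul locked_withE (bigD1 b) //= (bigD1 a) //=.
rewrite !big1 ?addr0.
- by rewrite hy hx.
- move=> b' ne; rewrite big1 // => a' _.
  by rewrite (hpart_homogeneous b' hy) (negPf ne) mul0r tens0r scaler0.
- move=> a' ne.
  by rewrite (hpart_homogeneous a' hx) (negPf ne) mulr0 tens0l scaler0.
Qed.

Fact tensor_part_homog c a b x y : homogeneous a x -> homogeneous b y ->
  tensor_part c (x ⊗ y) = if c == a (+) b then x ⊗ y else 0.
Proof.
move=> hx hy; rewrite /tensor_part locked_withE (tlift_tens _ _ (tensor_part_aux c)).
rewrite (bigD1 a) //= big1 ?addr0.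
  rewrite hx (hpart_homogeneous _ hy).
  by case: c a b {hx hy} => [] [] [] //=; rewrite tens0r.
move=> a' ne.
by rewrite (hpart_homogeneous a' hx) (negPf ne) tens0l.
Qed.

Fact tensor_mulP u : linear (tensor_mul ^~ u).
Proof. by rewrite /tensor_mul locked_withE; exact: tlift_linear (tensor_mul_aux u). Qed.

Fact tensor_mulDl : left_distributive tensor_mul +%R.
Proof. by move=> t u v; rewrite -[t]scale1r tensor_mulP !scale1r. Qed.

Fact tensor_mul0l u : tensor_mul 0 u = 0.
Proof. by apply: (addrI (tensor_mul 0 u)); rewrite -tensor_mulDl !addr0. Qed.

Fact tensor_mulZl k t u : tensor_mul (k *: t) u = k *: tensor_mul t u.
Proof. by rewrite -[k *: t]addr0 tensor_mulP tensor_mul0l addr0. Qed.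

Fact tensor_mulPr t : linear (tensor_mul t).
Proof.
move=> k u v; move: t; apply: tensor_ind => [t t' ht ht'|a b x y _ _].
  by rewrite !tensor_mulDl ht ht' scalerDr addrACA.
rewrite /tensor_mul locked_withE !(tlift_tens _ _ (tensor_mul_aux _)).
exact: tlift_linear (tens_mul_bilr x y) _ _ _.
Qed.

Fact tensor_mulDr : right_distributive tensor_mul +%R.
Proof. by move=> t u v; rewrite -[u]scale1r tensor_mulPr !scale1r. Qed.

Fact tensor_mul0r t : tensor_mul t 0 = 0.
Proof.
by apply: (addrI (tensor_mul t 0)); rewrite -tensor_mulDr !addr0.
Qed.

Fact tensor_mulZr k t u : tensor_mul t (k *: u) = k *: tensor_mul t u.
Proof. by rewrite -[k *: u]addr0 tensor_mulPr tensor_mul0r addr0. Qed.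

Fact tensor_mulA : associative tensor_mul.
Proof.
move=> t u v; move: t.
apply: tensor_ind => [t t' ht ht'|a1 b1 x1 y1 hx1 hy1].
  by rewrite !tensor_mulDl ht ht'.
move: u; apply: tensor_ind => [t t' ht ht'|a2 b2 x2 y2 hx2 hy2].
  by rewrite !(tensor_mulDl, tensor_mulDr) ht ht'.
move: v; apply: tensor_ind => [t t' ht ht'|a3 b3 x3 y3 hx3 hy3].
  by rewrite !tensor_mulDr ht ht'.
rewrite (tensor_mul_homog x2 y3 hy2 hx3) tensor_mulZr.
rewrite (tensor_mul_homog x1 y2 hy1 hx2) tensor_mulZl.
rewrite (tensor_mul_homog x1 _ hy1 (homogeneousM hx2 hx3)).
rewrite (tensor_mul_homog _ y3 (homogeneousM hy1 hy2) hx3).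
rewrite !scalerA !mulrA /tensor_sign; congr (_ *: _).
by case: (b1) (b2) (a2) (a3) => [] [] [] []; rewrite /= ?expr0 ?expr1 ?mulrNN ?mulr1 ?mul1r.
Qed.

Definition tensor1 : tensor := 1 ⊗ 1.

Fact tensor_mul1l : left_id tensor1 tensor_mul.
Proof.
apply: tensor_ind => [t u ht hu|a b x y hx hy]; first by rewrite tensor_mulDr ht hu.
by rewrite (tensor_mul_homog 1 y (homogeneous1 _) hx) scale1r !mul1r.
Qed.

Fact tensor_mul1r : right_id tensor1 tensor_mul.
Proof.
apply: tensor_ind => [t u ht hu|a b x y hx hy]; first by rewrite tensor_mulDl ht hu.
rewrite (tensor_mul_homog x 1 hy (homogeneous1 _)) /tensor_sign andbF.
by rewrite scale1r !mulr1.
Qed.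

HB.instance Definition _ := GRing.Zmodule_isPzRing.Build tensor
  tensor_mulA tensor_mul1l tensor_mul1r tensor_mulDl tensor_mulDr.

Definition tensor_C (k : K) : tensor := k *: tensor1.

Fact tensor_C_zmod_morphism : zmod_morphism tensor_C.
Proof. by move=> k l; rewrite /tensor_C scalerBl. Qed.
Fact tensor_CE k t : tensor_C k * t = k *: t.
Proof. by rewrite [LHS]tensor_mulZl tensor_mul1l. Qed.
Fact tensor_C_monoid_morphism : monoid_morphism tensor_C.
Proof.
split=> [|k l]; first by rewrite /tensor_C scale1r.
by rewrite tensor_CE /tensor_C scalerA.
Qed.
Fact tensor_C_central k t : tensor_C k * t = t * tensor_C k.
Proof. by rewrite tensor_CE [RHS]tensor_mulZr tensor_mul1r. Qed.

Fact tensor_part_linear c : linear (tensor_part c).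
Proof. by rewrite /tensor_part locked_withE; exact: tlift_linear (tensor_part_aux c). Qed.
Fact tensor_partD c : {morph tensor_part c : t u / t + u}.
Proof. by move=> t u; rewrite -[t]scale1r tensor_part_linear !scale1r. Qed.
Fact tensor_part0 c : tensor_part c 0 = 0.
Proof. by apply: (addrI (tensor_part c 0)); rewrite -tensor_partD !addr0. Qed.
Fact tensor_part_zmod_morphism c : zmod_morphism (tensor_part c).
Proof.
move=> t u; rewrite addrC -scaleN1r tensor_part_linear scaleN1r.
by rewrite addrC.
Qed.
Fact tensor_partZ c k t :
  tensor_part c (tensor_C k * t) = tensor_C k * tensor_part c t.
Proof.
by rewrite !tensor_CE -[k *: t]addr0 tensor_part_linear tensor_part0 addr0.
Qed.
Fact tensor_partK a b t :
  tensor_part a (tensor_part b t) = if a == b then tensor_part b t else 0.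
Proof.
move: t; apply: tensor_ind => [t u ht hu|c d x y hx hy].
  by rewrite !tensor_partD ht hu; case: eqP; rewrite ?addr0.
rewrite (tensor_part_homog b hx hy); case: (b =P c (+) d) => [->|_].
  by rewrite (tensor_part_homog a hx hy).
by rewrite tensor_part0 if_same.
Qed.
Fact tensor_part_sum t : tensor_part false t + tensor_part true t = t.
Proof.
move: t; apply: tensor_ind => [t u ht hu|c d x y hx hy].
  by rewrite !tensor_partD addrACA ht hu.
by rewrite !(tensor_part_homog _ hx hy); case: (c (+) d); rewrite ?addr0 ?add0r.
Qed.
Fact tensor_part1 : tensor_part false 1 = 1.
Proof.
exact: (tensor_part_homog false (homogeneous1 _)
  (homogeneous1 _)).
Qed.
Fact tensor_part_mul c t u : tensor_part c (t * u) =
  \sum_(a : bool) tensor_part a t * tensor_part (c (+) a) u.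
Proof.
move: t; apply: tensor_ind => [t t' ht ht'|a1 b1 x1 y1 hx1 hy1].
  rewrite mulrDl tensor_partD ht ht' -big_split /=.
  by apply: eq_bigr => a _; rewrite tensor_partD mulrDl.
move: u; apply: tensor_ind => [t t' ht ht'|a2 b2 x2 y2 hx2 hy2].
  rewrite mulrDr tensor_partD ht ht' -big_split /=.
  by apply: eq_bigr => a _; rewrite tensor_partD mulrDr.
under eq_bigr => a _ do
  rewrite (tensor_part_homog _ hx1 hy1) (tensor_part_homog _ hx2 hy2).
have e : (x1 ⊗ y1) * (x2 ⊗ y2)
    = tensor_sign b1 a2 *: ((x1 * x2) ⊗ (y1 * y2)) :> tensor.
  exact: tensor_mul_homog.
have eP : tensor_part c ((x1 ⊗ y1) * (x2 ⊗ y2)) =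
    if c == (a1 (+) a2) (+) (b1 (+) b2) then (x1 ⊗ y1) * (x2 ⊗ y2) else 0.
  rewrite e -[_ *: _]tensor_CE tensor_partZ.
  rewrite (tensor_part_homog _ (homogeneousM hx1 hx2) (homogeneousM hy1 hy2)).
  by case: eqP => _; rewrite ?mulr0.
rewrite eP big_bool /=.
by case: (a1) (b1) (a2) (b2) (c) => [] [] [] [] [];
  rewrite /= ?(mul0r, mulr0, add0r, addr0).
Qed.
Fact tensor_partM a b t u : tensor_part a t = t -> tensor_part b u = u ->
  tensor_part (a (+) b) (t * u) = t * u.
Proof.
move=> ht hu; rewrite tensor_part_mul -ht -hu.
under eq_bigr => c _ do rewrite !tensor_partK.
rewrite ht hu big_bool /=.
by case: (a) (b) => [] []; rewrite /= ?(mul0r, mulr0, add0r, addr0).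
Qed.

HB.instance Definition _ := isSuperalgebra.Build K tensor
  tensor_C_zmod_morphism tensor_C_monoid_morphism tensor_C_central
  tensor_part_zmod_morphism tensor_partZ tensor_partK tensor_part_sum
  tensor_part1 tensor_partM.

Lemma tensM b a x y x' y' : homogeneous b y -> homogeneous a x' ->
  (x ⊗ y) * (x' ⊗ y') = (-1) ^+ (b && a) ∙ ((x * x') ⊗ (y * y')) :> tensor.
Proof. by move=> hy hx; rewrite /sscale tensor_CE; exact: tensor_mul_homog. Qed.

Lemma sscale_tensor k (t : tensor) : k ∙ t = k *: t.
Proof. exact: tensor_CE. Qed.

End TensorProduct.

Notation "x ⊗ y" := (tens x y) (at level 40, left associativity) : ring_scope.

(* The Clifford algebra (Cl), the degenerate affine Hecke-Clifford algebra    *)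
(* (Hc) and the degenerate spin affine Hecke algebra (Hm).  The indices       *)
(* 1..n are represented by 'I_n, and the indices 1..n-1 of the simple         *)
(* transpositions by i : 'I_n.-1, with ord_lo i and ord_hi i standing for the *)
(* points i and i+1.                                                          *)

Definition ord_lo (n : nat) (i : 'I_n.-1) : 'I_n := widen_ord (leq_pred n) i.

Fact ord_hi_subproof (n : nat) (i : 'I_n.-1) : (i.+1 < n)%N.
Proof. by case: n i => [|n] [m hm]. Qed.

Definition ord_hi (n : nat) (i : 'I_n.-1) : 'I_n := Ordinal (ord_hi_subproof i).

Definition simple_transp (n : nat) (i : 'I_n.-1) : 'S_n :=
  tperm (ord_lo i) (ord_hi i).

Section Clifford.
Variables (K : fieldType) (n : nat).
Local Notation c i := (fgen K i).

Inductive clifford_rel : freealg K 'I_n -> freealg K 'I_n -> Prop :=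
| Cl_cc i : clifford_rel (c i * c i) 1
| Cl_cc_anti i j of i != j : clifford_rel (c i * c j) (- (c j * c i)).

Definition clifford_par (_ : 'I_n) : bool := true.

Fact clifford_homogeneous l r : clifford_rel l r ->
  exists b, fpart clifford_par b l = l /\ fpart clifford_par b r = r.
Proof.
have hc i : fpart clifford_par true (c i) = c i by exact: fhom_gen.
case=> [i|i j _]; exists false.
- by split; [exact: (fhomM (hc i) (hc i)) | exact: fhom1].
- by split; [|apply: fhomN]; exact: (fhomM (hc _) (hc _)).
Qed.

Definition clifford : superalgType K :=
  presalg (Presentation clifford_homogeneous).

Definition Cl_c (i : 'I_n) : clifford :=
  presalg_gen (p := Presentation clifford_homogeneous) i.

End Clifford.

Section HeckeClifford.
Variables (K : fieldType) (n : nat).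

Definition hc_gen : choiceType := ('I_n + 'I_n + 'S_n)%type.
Definition hc_ga (i : 'I_n) : hc_gen := inl (inl i).
Definition hc_gc (i : 'I_n) : hc_gen := inl (inr i).
Definition hc_gs (s : 'S_n) : hc_gen := inr s.

Definition hc_par (g : hc_gen) : bool := if g is inl (inr _) then true else false.

Local Notation a i := (fgen K (hc_ga i)).
Local Notation c i := (fgen K (hc_gc i)).
Local Notation sigma s := (fgen K (hc_gs s)).
Local Notation st i := (sigma (simple_transp i)).

(* In 'S_n the product (t * s)%g is "t, then s": it is the composite that is  *)
(* usually written st, for which sigma c_i = c_(sigma i) sigma is consistent. *)
Inductive hc_rel : freealg K hc_gen -> freealg K hc_gen -> Prop :=
| Hc_sigma1 : hc_rel (sigma 1%g) 1
| Hc_sigmaM (s t : 'S_n) : hc_rel (sigma s * sigma t) (sigma (t * s)%g)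
| Hc_sigmac (s : 'S_n) (i : 'I_n) : hc_rel (sigma s * c i) (c (s i) * sigma s)
| Hc_cc i : hc_rel (c i * c i) 1
| Hc_cc_anti i j of i != j : hc_rel (c i * c j) (- (c j * c i))
| Hc_as (i : 'I_n.-1) (j : 'I_n) of j != ord_lo i & j != ord_hi i :
    hc_rel (a j * st i) (st i * a j)
| Hc_as_affine (i : 'I_n.-1) :
    hc_rel (a (ord_hi i) * st i - st i * a (ord_lo i))
           (1 - c (ord_hi i) * c (ord_lo i))
| Hc_ca i : hc_rel (c i * a i) (- (a i * c i))
| Hc_aa i j : hc_rel (a i * a j) (a j * a i)
| Hc_ca_comm i j of i != j : hc_rel (c j * a i) (a i * c j).

Fact hc_homogeneous l r : hc_rel l r ->
  exists b, fpart hc_par b l = l /\ fpart hc_par b r = r.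
Proof.
have ha i : fpart hc_par false (a i) = a i by exact: (@fhom_gen K _ hc_par (hc_ga i)).
have hc i : fpart hc_par true (c i) = c i by exact: (@fhom_gen K _ hc_par (hc_gc i)).
have hs s : fpart hc_par false (sigma s) = sigma s
  by exact: (@fhom_gen K _ hc_par (hc_gs s)).
have h1 : fpart hc_par false (1 : freealg K hc_gen) = 1 by exact: fhom1.
case=> [|s t|s i|i|i j _|i j _ _|i|i|i j|i j _].
- by exists false.
- by exists false; split=> //; exact: (fhomM (hs _) (hs _)).
- exists true; split; [exact: (fhomM (hs _) (hc _))|exact: (fhomM (hc _) (hs _))].
- by exists false; split=> //; exact: (fhomM (hc _) (hc _)).
- by exists false; split; [|apply: fhomN]; exact: (fhomM (hc _) (hc _)).
- exists false; split; [exact: (fhomM (ha _) (hs _))|exact: (fhomM (hs _) (ha _))].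
- exists false; split; apply: fhomD => //; try apply: fhomN.
  + exact: (fhomM (ha _) (hs _)).
  + exact: (fhomM (hs _) (ha _)).
  + exact: (fhomM (hc _) (hc _)).
- exists true; split; [|apply: fhomN].
  + exact: (fhomM (hc _) (ha _)).
  + exact: (fhomM (ha _) (hc _)).
- by exists false; split; exact: (fhomM (ha _) (ha _)).
- exists true; split; [exact: (fhomM (hc _) (ha _))|exact: (fhomM (ha _) (hc _))].
Qed.

Definition hecke_clifford : superalgType K :=
  presalg (Presentation hc_homogeneous).

Definition Hc_gen (g : hc_gen) : hecke_clifford :=
  presalg_gen (p := Presentation hc_homogeneous) g.
Definition Hc_a (i : 'I_n) := Hc_gen (hc_ga i).
Definition Hc_c (i : 'I_n) := Hc_gen (hc_gc i).
Definition Hc_sigma (s : 'S_n) := Hc_gen (hc_gs s).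
Definition Hc_s (i : 'I_n.-1) := Hc_sigma (simple_transp i).

End HeckeClifford.

Section SpinHecke.
Variables (K : fieldType) (n : nat).

Definition hm_gen : choiceType := ('I_n + 'I_n.-1)%type.
Definition hm_gb (i : 'I_n) : hm_gen := inl i.
Definition hm_gt (i : 'I_n.-1) : hm_gen := inr i.

Definition hm_par (_ : hm_gen) : bool := true.

Local Notation b i := (fgen K (hm_gb i)).
Local Notation t i := (fgen K (hm_gt i)).

Inductive hm_rel : freealg K hm_gen -> freealg K hm_gen -> Prop :=
| Hm_tt i : hm_rel (t i * t i) 1
| Hm_braid (i j : 'I_n.-1) of j = i.+1 :> nat :
    hm_rel (t i * t j * t i) (t j * t i * t j)
| Hm_tt_anti (i j : 'I_n.-1) of (i.+1 < j)%N || (j.+1 < i)%N :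
    hm_rel (t i * t j) (- (t j * t i))
| Hm_bb_anti i j of i != j : hm_rel (b i * b j) (- (b j * b i))
| Hm_bt_affine (i : 'I_n.-1) :
    hm_rel (b (ord_hi i) * t i) (- (t i * b (ord_lo i)) + 1)
| Hm_tb_anti (j : 'I_n.-1) (i : 'I_n) of i != ord_lo j & i != ord_hi j :
    hm_rel (t j * b i) (- (b i * t j)).

Fact hm_homogeneous l r : hm_rel l r ->
  exists b, fpart hm_par b l = l /\ fpart hm_par b r = r.
Proof.
have hg g : fpart hm_par true (fgen K g) = fgen K g
  by exact: (@fhom_gen K _ hm_par g).
have hg2 g h : fpart hm_par false (fgen K g * fgen K h) = fgen K g * fgen K h.
  exact: (fhomM (hg g) (hg h)).
case=> [i|i j _|i j _|i j _|i|j i _ _].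
- by exists false; split=> //; exact: fhom1.
- by exists true; split; exact: (fhomM (hg2 _ _) (hg _)).
- by exists false; split=> //; exact: fhomN.
- by exists false; split=> //; exact: fhomN.
- by exists false; split=> //; apply: fhomD; [exact: fhomN|exact: fhom1].
- by exists false; split=> //; exact: fhomN.
Qed.

Definition spin_hecke : superalgType K :=
  presalg (Presentation hm_homogeneous).

Definition Hm_gen (g : hm_gen) : spin_hecke :=
  presalg_gen (p := Presentation hm_homogeneous) g.
Definition Hm_b (i : 'I_n) := Hm_gen (hm_gb i).
Definition Hm_t (i : 'I_n.-1) := Hm_gen (hm_gt i).

End SpinHecke.

(* Main.v *)
From HB Require Import structures.
Require Import Defs.
From mathcomp Require Import all_boot all_order all_algebra all_fingroup.
From mathcomp Require Import reals.
From mathcomp Require Import complex.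
From mathcomp Require Import finmap monalg.
From mathcomp Require Import zify.

(** Both algebras contain the Clifford algebra, and the isomorphism says that the
    Hecke-Clifford algebra is the Clifford algebra times the part that anticommutes
    with it. The element c_i a_i anticommutes with every c_j. So does
    (c_(i+1) - c_i) s_i, since conjugation by s_i exchanges c_i and c_(i+1), while
    conjugation by the vector c_i - c_(i+1) of the Clifford algebra does the same up
    to a sign ([clifford_diff_c]). Divided by the square root r of - 2 these elements
    satisfy the relations of b_i and t_i; multiplying back by the Clifford factors
    recovers a_i and s_i, because c_i squares to 1 and c_i - c_(i+1) squares to 2.

    Each direction is a universal property. A map out of a presented superalgebra is
    given by homogeneous images of the generators that satisfy the relations
    ([presalg_universal]), and a map out of a graded tensor product by two
    homomorphisms whose images commute up to the sign rule ([tensor_universal]),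
    which is checked on generators ([presalg_supercommute]). Two homomorphisms that
    agree on generators are equal, so the composites are the identity by a short
    computation ([clifford_scale_cancel], [clifford_diff_cancel]).

    The relations to check are computations with the elements D_i = c_i - c_(i+1):
    these satisfy D_i^2 = 2, anticommute at distance at least 2, and satisfy the braid
    relation ([clifford_diff_braid]). From them follow the relations of the images
    in both directions ([hecke_affine], [spin_t_braid], [spin_affine] and their
    neighbours).

    One point is not a computation. The Hecke-Clifford algebra has a generator for
    every permutation, while the isomorphism prescribes only the images of simple
    transpositions. That these extend is the Coxeter presentation of the symmetric
    group ([coxeter_presentation]). It is proved by sorting: a permutation is
    reduced at a descent until it is the identity, and the Coxeter relations make the
    outcome independent of the descents chosen ([descent_confluent]). *)

Set Implicit Arguments.
Unset Strict Implicit.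
Unset Printing Implicit Defensive.

Import GRing.Theory.
Local Open Scope ring_scope.

(** * The Coxeter presentation of the symmetric group *)

Section SimpleTranspositions.
Variable n : nat.
Implicit Types (i j : 'I_n.-1) (k : 'I_n) (w : 'S_n).
Local Notation s i := (simple_transp i).

Lemma ord_lo_neq_hi i : ord_lo i != ord_hi i.
Proof. by rewrite -val_eqE /= neq_ltn ltnSn. Qed.

Lemma simple_transp_lo i : s i (ord_lo i) = ord_hi i.
Proof. exact: tpermL. Qed.

Lemma simple_transp_hi i : s i (ord_hi i) = ord_lo i.
Proof. exact: tpermR. Qed.

Lemma simple_transp_other i k : k != ord_lo i -> k != ord_hi i -> s i k = k.
Proof. by rewrite eq_sym => h; rewrite eq_sym => h'; exact: tpermD. Qed.

Lemma simple_transpK i : (s i * s i = 1)%g.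
Proof. exact: tperm2. Qed.

Section Adjacent.
Variables i j : 'I_n.-1.
Hypothesis e : j = i.+1 :> nat.

Lemma ord_lo_adjacent : ord_lo j = ord_hi i.
Proof. exact: val_inj. Qed.

Lemma simple_transp_adjacent_lo : s j (ord_lo i) = ord_lo i.
Proof. by apply: simple_transp_other; rewrite -val_eqE /= e; lia. Qed.

Lemma simple_transp_adjacent_hi : s i (ord_hi j) = ord_hi j.
Proof. by apply: simple_transp_other; rewrite -val_eqE /= e; lia. Qed.

End Adjacent.

Lemma simple_transp_braid i j : j = i.+1 :> nat ->
  (s i * s j * s i = s j * s i * s j)%g.
Proof.
move=> e; have el := ord_lo_adjacent e.
(* Both sides are the transposition of the outer points ord_lo i, ord_hi j. *)
have := tpermJ (ord_lo i) (ord_hi i) (s j).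
have := tpermJ (ord_lo j) (ord_hi j) (s i).
rewrite !conjgE !tpermV -/(s i) -/(s j) !mulgA => -> ->.
rewrite (simple_transp_adjacent_lo e) (simple_transp_adjacent_hi e).
by rewrite -[in RHS]el simple_transp_lo el simple_transp_hi.
Qed.


Lemma simple_transp_comm i j : (i.+1 < j)%N -> (s i * s j = s j * s i)%g.
Proof.
move=> lt; rewrite [LHS]conjgC; congr mulg; rewrite tpermJ.
by rewrite !simple_transp_other // -val_eqE /=; lia.
Qed.

(** In 'S_n the product (u * w)%g applies u first, so s i * w exchanges the values
    of w at the positions i and i+1; a descent is where that sorts them. *)
Definition descent w i := (w (ord_hi i) < w (ord_lo i))%N.

(** This measure replaces the number of inversions: sorting a descent at the
    positions l, l+1 lowers it by the difference of the two values. *)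
Definition disorder w : nat := \sum_(k < n) k * (n - w k).

Lemma disorder_descent w i : descent w i -> (disorder (s i * w)%g < disorder w)%N.
Proof.
move=> d; rewrite /disorder.
have hl : ord_hi i != ord_lo i by rewrite eq_sym ord_lo_neq_hi.
have split2 (F : 'I_n -> nat) : (\sum_(k < n) F k = F (ord_lo i) + F (ord_hi i) +
    \sum_(k < n | (k != ord_lo i) && (k != ord_hi i)) F k)%N.
  by rewrite (bigD1 (ord_lo i)) //= (bigD1 (ord_hi i)) //= addnA.
rewrite !split2 !permM simple_transp_lo simple_transp_hi.
under eq_bigr => k /andP[h1 h2] do rewrite permM (simple_transp_other h1 h2).
rewrite ltn_add2r /=; move: d; rewrite /descent.
set x := w (ord_lo i); set y := w (ord_hi i) => d.
have := ltn_ord x; have := ltn_ord y; move: d.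
move: (nat_of_ord x) (nat_of_ord y) (nat_of_ord i) => a b m d hb ha.
rewrite !mulSn.
lia.
Qed.

(** Without descents w is nondecreasing, and by strong induction on k the value k
    can neither be skipped nor be taken later than at position k. *)
Lemma no_descent_id w : (forall i, ~~ descent w i) -> w = 1%g.
Proof.
move=> nd.
have mono (k l : 'I_n) : (k <= l)%N -> (w k <= w l)%N.
  case: l => l hl /=; elim: l hl => [|l IH] hl.
    by rewrite leqn0 => /eqP k0; rewrite (_ : k = Ordinal hl) //; apply: val_inj.
  rewrite leq_eqVlt ltnS => /orP[/eqP e|le].
    by rewrite (_ : k = Ordinal hl) //; apply: val_inj.
  have hl' : (l < n)%N by apply: ltnW.
  have hi : (l < n.-1)%N by lia.
  apply: leq_trans (IH hl' le) _; have := nd (Ordinal hi).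
  rewrite /descent -leqNgt.
  by congr (_ <= _)%N; congr (val (w _)); apply: val_inj.
apply/permP => k; rewrite perm1; apply: val_inj.
(* Both inequalities are refuted by injectivity: a point below k is fixed. *)
case: k => k; elim/ltn_ind: k => k IH hk /=.
apply/eqP; rewrite eqn_leq; apply/andP; split.
- have hm : w (w^-1 (Ordinal hk))%g = Ordinal hk by rewrite permKV.
  suff : (w (Ordinal hk) <= w (w^-1 (Ordinal hk))%g)%N by rewrite hm.
  apply: mono => /=; rewrite leqNgt; apply/negP => lt.
  move: (IH _ lt (ltn_ord _)); rewrite (_ : Ordinal _ = (w^-1 (Ordinal hk))%g); last exact: val_inj.
  by rewrite hm /= => e; rewrite -e ltnn in lt.
- rewrite leqNgt; apply/negP => lt.
  move: (IH _ lt (ltn_ord _)); rewrite (_ : Ordinal _ = w (Ordinal hk)); last exact: val_inj.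
  by move/val_inj/perm_inj => e; rewrite e /= ltnn in lt.
Qed.

(** Sorting a permutation by descents writes it as a product of simple
    transpositions; the induction is on the disorder. *)
Lemma perm_simple_ind (P : 'S_n -> Prop) :
  P 1%g -> (forall i w, P w -> P (s i * w)%g) -> forall w, P w.
Proof.
move=> P1 PS w; have [m] := ubnP (disorder w); elim: m w => // m IH w /ltnSE le.
case: (pickP (descent w)) => [i d|nd].
  rewrite -[w]mul1g -(simple_transpK i) -mulgA; apply/PS/IH.
  exact: leq_trans (disorder_descent d) le.
by rewrite (@no_descent_id w) // => i; rewrite nd.
Qed.

Section Coxeter.
Variables (M : pzSemiRingType) (S : 'I_n.-1 -> M).
Hypothesis S2 : forall i, S i * S i = 1.
Hypothesis Sbraid : forall i j, j = i.+1 :> nat -> S i * S j * S i = S j * S i * S j.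
Hypothesis Scomm : forall i j, (i.+1 < j)%N -> S i * S j = S j * S i.

(** A function on 'S_n that is computed by sorting: it is prescribed on a
    permutation of disorder below N by its value after sorting any descent. *)
Definition descends_below N (f : 'S_n -> M) :=
  f 1%g = 1 /\ forall w i, (disorder w < N)%N -> descent w i ->
    f w = f (s i * w)%g * S i.

(** The independence of the choice of a descent. If two descents are at distance at
    least 2, both remain after sorting one of them, and the commutation relation
    closes the square. If they are adjacent, w takes three decreasing values, which
    are sorted by either side of the braid relation. *)
Lemma descent_confluent N f w i j : descends_below N f -> (disorder w <= N)%N ->
  descent w i -> descent w j -> f (s i * w)%g * S i = f (s j * w)%g * S j.
Proof.
move=> [_ hf] le.
wlog ij : i j / (i <= j)%N => [W di dj|].
  by case/orP: (leq_total i j) => h; [|apply/esym]; exact: W.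
move: ij; rewrite leq_eqVlt => /orP[/eqP/val_inj -> //|].
move=> lt di dj.
have mi := leq_trans (disorder_descent di) le.
have mj := leq_trans (disorder_descent dj) le.
case: (ltngtP i.+1 j) lt => // [lt _|e _].
- have hi : s j (ord_hi i) = ord_hi i by apply: simple_transp_other; rewrite -val_eqE /=; lia.
  have li : s j (ord_lo i) = ord_lo i by apply: simple_transp_other; rewrite -val_eqE /=; lia.
  have hj : s i (ord_hi j) = ord_hi j by apply: simple_transp_other; rewrite -val_eqE /=; lia.
  have lj : s i (ord_lo j) = ord_lo j by apply: simple_transp_other; rewrite -val_eqE /=; lia.
  rewrite (hf _ j mi) ?(hf _ i mj) /descent ?permM ?hi ?li ?hj ?lj //.
  by rewrite -!mulrA (Scomm lt) !mulgA (simple_transp_comm lt).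
- have el : ord_lo j = ord_hi i by apply: val_inj; rewrite /= e.
  have li : s j (ord_lo i) = ord_lo i by apply: simple_transp_other; rewrite -val_eqE /=; lia.
  have hj : s i (ord_hi j) = ord_hi j by apply: simple_transp_other; rewrite -val_eqE /=; lia.
  have hi : s j (ord_hi i) = ord_hi j by rewrite -el simple_transp_lo.
  have lj : s i (ord_hi i) = ord_lo i by rewrite simple_transp_hi.
  have hj' : s j (ord_hi j) = ord_hi i by rewrite simple_transp_hi.
  have li' := simple_transp_lo i.
  have xz : (w (ord_hi j) < w (ord_lo i))%N.
    by apply: ltn_trans di; move: dj; rewrite /descent el.
  have dij : descent (s i * w)%g j by rewrite /descent !permM el hj lj.
  have dji : descent (s j * w)%g i by rewrite /descent !permM hi li.
  have dij' : descent (s j * (s i * w))%g i.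
    by move: dj; rewrite /descent !permM hi li hj li' el.
  have dji' : descent (s i * (s j * w))%g j.
    by move: di; rewrite /descent !permM el hj lj li hj'.
  rewrite (hf _ _ mi dij) (hf _ _ mj dji).
  rewrite (hf _ _ (ltn_trans (disorder_descent dij) mi) dij').
  rewrite (hf _ _ (ltn_trans (disorder_descent dji) mj) dji').
  by rewrite -!mulrA (mulrA (S i)) (mulrA (S j)) Sbraid // !mulgA simple_transp_braid.
Qed.

(** Each step sorts one descent, chosen arbitrarily; the confluence lemma shows that
    every other descent gives the same value. *)
Lemma descends_below_ex N : exists f, descends_below N f.
Proof.
elim: N => [|N [f fN]]; first by exists (fun=> 1).
exists (fun w => if (disorder w < N)%N then f w else
  if [pick i | descent w i] is Some i then f (s i * w)%g * S i else 1).
split=> [|w i].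
  case: ifP => _; first by case: fN.
  by case: pickP => // i; rewrite /descent !perm1 /=; lia.
rewrite ltnS => le d; case: ifP => [lt|_].
  by rewrite (ltn_trans (disorder_descent d) lt); case: fN => _; apply.
rewrite (leq_trans (disorder_descent d) le); case: pickP => [j dj|/(_ i)]; last by rewrite d.
exact: descent_confluent fN le dj d.
Qed.

(** The Coxeter presentation of the symmetric group, in the existence form: elements
    of the multiplicative monoid of a semiring that satisfy the Coxeter relations
    extend to the whole group. The extension reverses products because 'S_n composes
    from left to right. *)
Theorem coxeter_presentation : exists f : 'S_n -> M,
  [/\ f 1%g = 1, forall u w, f (u * w)%g = f w * f u & forall i, f (s i) = S i].
Proof.
have [f [f1 fd]] := descends_below_ex (\max_w disorder w).+1.
have fS i w : f (s i * w)%g = f w * S i.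
  have lt v : (disorder v < (\max_u disorder u).+1)%N by rewrite ltnS leq_bigmax.
  case: (ltngtP (w (ord_hi i)) (w (ord_lo i))) => [d|d|/val_inj/perm_inj e].
  - by rewrite (fd w i) // -mulrA S2 mulr1.
  - rewrite (fd (s i * w)%g i) // ?mulgA ?simple_transpK ?mul1g //.
    by rewrite /descent !permM simple_transp_lo simple_transp_hi.
  - by have := ord_lo_neq_hi i; rewrite e eqxx.
exists f; split=> // [u w|i]; last by rewrite -[s i]mulg1 fS f1 mul1r.
elim/perm_simple_ind: u => [|i u IH]; first by rewrite mul1g f1 mulr1.
by rewrite -mulgA !fS IH mulrA.
Qed.

End Coxeter.
End SimpleTranspositions.

(** * Homomorphisms of superalgebras *)

(** A superalgebra as a vector space: linear extension from a basis and the lift of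
    bilinear maps to a tensor product take values in an lmodType, and this alias
    carries that structure on an abstract superalgebra. *)
Definition slmod (K : fieldType) (A : superalgType K) : Type := A.

Section SuperalgebraModule.
Variables (K : fieldType) (A : superalgType K).
HB.instance Definition _ := GRing.Zmodule.on (slmod A).
Fact slmodA (a b : K) (v : slmod A) :
  sscale a (sscale b v : A) = sscale (a * b) (v : A).
Proof. exact: sscaleA. Qed.
HB.instance Definition _ := GRing.Zmodule_isLmodule.Build K (slmod A)
  slmodA (@sscale1 K A) (@sscaleDr K A) (fun v k l => @sscaleDl K A k l v).

Lemma sscaleM k l (x y : A) : (k ∙ x) * (l ∙ y) = (k * l) ∙ (x * y).
Proof. by rewrite -sscaleAl -sscaleAr sscaleA. Qed.

Lemma sscaleN k (x : A) : k ∙ (- x) = - (k ∙ x).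
Proof. exact: mulrN. Qed.

Lemma sscaleNl k (x : A) : (- k) ∙ x = - (k ∙ x).
Proof. by rewrite /sscale rmorphN mulNr. Qed.

Lemma sscale_nat k m (x : A) : k ∙ (x *+ m) = (k *+ m) ∙ x.
Proof. by rewrite /sscale mulrnAr rmorphMn mulrnAl. Qed.

(** Signs of the tensor product are scalars, whereas signs of the defining relations
    are elements of the ring. *)
Lemma sscale_sign k (x : A) : (-1) ^+ k ∙ x = (-1) ^+ k * x.
Proof. by rewrite /sscale rmorph_sign. Qed.

Lemma homogeneous0 b : homogeneous b (0 : A).
Proof. exact: raddf0. Qed.

Lemma homogeneousD b (x y : A) :
  homogeneous b x -> homogeneous b y -> homogeneous b (x + y).
Proof. by rewrite /homogeneous raddfD /= => -> ->. Qed.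

Lemma homogeneousN b (x : A) : homogeneous b x -> homogeneous b (- x).
Proof. by rewrite /homogeneous raddfN /= => ->. Qed.

Lemma homogeneousZ b k (x : A) : homogeneous b x -> homogeneous b (k ∙ x).
Proof. by rewrite /homogeneous /sscale hpartZ => ->. Qed.

End SuperalgebraModule.

Section SuperalgebraHom.
Variables (K : fieldType) (A B : superalgType K) (f : A -> B).
Hypothesis hf : superalg_hom f.

Lemma superalg_homB x y : f (x - y) = f x - f y.
Proof. by case: hf. Qed.

Lemma superalg_hom0 : f 0 = 0.
Proof. by rewrite -(subrr 0) superalg_homB subrr. Qed.

Lemma superalg_homN x : f (- x) = - f x.
Proof. by rewrite -sub0r superalg_homB superalg_hom0 sub0r. Qed.

Lemma superalg_homD x y : f (x + y) = f x + f y.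
Proof. by rewrite -[y in LHS]opprK superalg_homB superalg_homN opprK. Qed.

Lemma superalg_hom1 : f 1 = 1.
Proof. by case: hf => _ []. Qed.

Lemma superalg_homM x y : f (x * y) = f x * f y.
Proof. by case: hf => _ [_ ->]. Qed.

Lemma superalg_homZ k x : f (k ∙ x) = k ∙ f x.
Proof. by case: hf. Qed.

Lemma superalg_hom_homogeneous b x : homogeneous b x -> homogeneous b (f x).
Proof. by case: hf => _ _ _; exact. Qed.

End SuperalgebraHom.

Lemma superalg_hom_id (K : fieldType) (A : superalgType K) :
  superalg_hom (fun x : A => x).
Proof. by split. Qed.

Lemma superalg_hom_comp (K : fieldType) (A B C : superalgType K)
    (f : A -> B) (g : B -> C) :
  superalg_hom f -> superalg_hom g -> superalg_hom (g \o f).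
Proof.
move=> hf hg; split=> [x y||k x|b x hx] /=.
- by rewrite (superalg_homB hf) (superalg_homB hg).
- split=> [|x y] /=; first by rewrite (superalg_hom1 hf) (superalg_hom1 hg).
  by rewrite (superalg_homM hf) (superalg_homM hg).
- by rewrite (superalg_homZ hf) (superalg_homZ hg).
- exact: superalg_hom_homogeneous hg _ _ (superalg_hom_homogeneous hf hx).
Qed.

(** * Universal property of presented superalgebras *)

Lemma fmonom_ind (I : choiceType) (P : {fmonom I} -> Prop) :
  P mone -> (forall g m, P m -> P (mmul (fmu g) m)) -> forall m, P m.
Proof.
move=> P1 PM [s]; elim: s => [|g s IH].
  by rewrite (_ : FMonom [::] = mone) //; apply: val_inj; rewrite /= fm1.
rewrite (_ : FMonom (g :: s) = mmul (fmu g) (FMonom s)); first exact: PM.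
by apply: val_inj; rewrite /= fmM fmU.
Qed.

Section PresentedInd.
Variables (K : fieldType) (p : presentation K).
Local Notation F := (freealg K (pgen p)).
Local Notation pi := (lpi (@ideal_gen K p) : F -> presalg p).

Lemma presalg_piP k u v : pi (k *: u + v) = k ∙ (pi u : presalg p) + pi v.
Proof. by rewrite lpiD /sscale [_ * _]presalg_C_pi. Qed.

(** Homogeneous elements are linear combinations of monomials of the same parity:
    the projection of a monomial to a parity is that monomial or zero. Hence a
    parity-indexed property needs to be checked only on generators. *)
Lemma presalg_homogeneous_ind (P : bool -> presalg p -> Prop) :
  (forall b, P b 0) ->
  (forall b k x y, P b x -> P b y -> P b (k ∙ x + y)) ->
  P false 1 ->
  (forall g, P (ppar g) (presalg_gen g)) ->
  (forall a b x y, P a x -> P b y -> P (a (+) b) (x * y)) ->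
  forall b x, homogeneous b x -> P b x.
Proof.
move=> P0 PD P1 PG PM b x hx.
suff h (u : F) : P b (pi (fpart (@ppar K p) b u)).
  by rewrite -hx -[x]lreprK [hpart b _]presalg_partE; exact: h.
move: u; apply: malg_lin_ind => [|k u v hu hv|m].
- by rewrite !linear0.
- rewrite (_ : fpart _ _ _ = k *: fpart (@ppar K p) b u + fpart (@ppar K p) b v).
    by rewrite presalg_piP; exact: PD.
  exact: linearP.
rewrite fpartU; case: eqP => [<- {b x hx}|_]; last by rewrite linear0.
(* The hypothesis on products applies with the parities of the two factors. *)
elim/fmonom_ind: m => [|g m IH]; first by rewrite wpar1.
rewrite wparM -freeUM presalg_piM; apply: PM IH.
by rewrite /wpar fmU big_seq1; exact: PG.
Qed.
End PresentedInd.

Section FreeEvaluation.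
Variables (K : fieldType) (G : choiceType) (B : superalgType K) (phi : G -> B).

Definition free_eval : freealg K G -> slmod B :=
  mext (fun m : {fmonom G} => (\prod_(g <- m) phi g : B) : slmod B).

HB.instance Definition _ := GRing.Linear.on free_eval.

Lemma free_eval_gen g : free_eval (fgen K g) = phi g.
Proof. by rewrite /free_eval mextU fmU big_seq1. Qed.

Lemma free_eval1 : free_eval 1 = (1 : B).
Proof. by rewrite /free_eval mextU fm1 big_nil. Qed.

Lemma free_evalM u v : free_eval (u * v) = (free_eval u : B) * (free_eval v : B).
Proof.
move: u; apply: malg_lin_ind => [|k u w hu hw|m].
- by rewrite mul0r !linear0 mul0r.
- rewrite mulrDl -scalerAl !linearP /= hu hw.
  by rewrite -[k *: (_ * _ : slmod B)]/(k ∙ (_ * _)) sscaleAl -mulrDl.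
move: v; apply: malg_lin_ind => [|k u w hu hw|m'].
- by rewrite mulr0 !linear0 mulr0.
- rewrite mulrDr -free_scalerAr !linearP /= hu hw.
  by rewrite -[k *: (_ * _ : slmod B)]/(k ∙ (_ * _)) sscaleAr -mulrDr.
by rewrite freeUM /free_eval !mextU fmM big_cat.
Qed.

(** This rule and the next two build the value of an expression by a term of the same
    shape; thus two monomials are never compared up to conversion, which would unfold
    the multiplication of the free algebra. *)
Lemma free_eval_mul u v x y : free_eval u = x -> free_eval v = y ->
  free_eval (u * v) = (x * y : B).
Proof. by move=> <- <-; exact: free_evalM. Qed.

Lemma free_eval_add u v x y : free_eval u = x -> free_eval v = y ->
  free_eval (u + v) = (x + y : B).
Proof. by move=> <- <-; exact: raddfD. Qed.

Lemma free_eval_opp u x : free_eval u = x -> free_eval (- u) = (- x : B).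
Proof. by move=> <-; exact: raddfN. Qed.

End FreeEvaluation.

Section PresentedHom.
Variables (K : fieldType) (p : presentation K) (B : superalgType K).
Local Notation F := (freealg K (pgen p)).
Local Notation pi := (lpi (@ideal_gen K p) : F -> presalg p).

Section Lift.
Variable phi : pgen p -> B.
Hypothesis phi_hom : forall g, homogeneous (ppar g) (phi g).
Hypothesis phi_rel : forall l r, prel (p := p) l r -> free_eval phi l = free_eval phi r.

Definition presalg_lift (x : presalg p) : B := free_eval phi (lrepr x).

Lemma presalg_lift_pi u : presalg_lift (pi u) = free_eval phi u.
Proof.
apply: (@lquot_lift _ _ _ _ (free_eval phi)) => _ [w l r z rlr].
by rewrite /= !free_evalM raddfB /= (phi_rel rlr) subrr mulr0 mul0r.
Qed.

Lemma presalg_lift_gen g : presalg_lift (presalg_gen g) = phi g.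
Proof. by rewrite presalg_lift_pi free_eval_gen. Qed.

Lemma presalg_lift_hom : superalg_hom presalg_lift.
Proof.
have lB x y : presalg_lift (x - y) = presalg_lift x - presalg_lift y.
  rewrite -[x]lreprK -[y]lreprK -[_ - _](lpiB (@ideal_gen K p)).
  by rewrite !presalg_lift_pi raddfB.
have l0 : presalg_lift 0 = 0 by rewrite -(subrr 0) lB subrr.
have lD x y : presalg_lift (x + y) = presalg_lift x + presalg_lift y.
  by rewrite -[y in LHS]opprK lB -[- y]sub0r lB l0 sub0r opprK.
have lM x y : presalg_lift (x * y) = presalg_lift x * presalg_lift y.
  rewrite -[x]lreprK -[y]lreprK -[_ * _](presalg_piM (p := p)).
  by rewrite !presalg_lift_pi free_evalM.
have l1 : presalg_lift 1 = 1 by rewrite presalg_lift_pi free_eval1.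
have lZ k x : presalg_lift (k ∙ x) = k ∙ presalg_lift x.
  by rewrite -[x]lreprK /sscale [_ * _]presalg_C_pi !presalg_lift_pi linearZ.
split=> // b x; move: b x; apply: presalg_homogeneous_ind => [b|b k x y hx hy||g|a b x y hx hy].
- by rewrite l0; exact: homogeneous0.
- by rewrite lD lZ; exact: homogeneousD (homogeneousZ _ hx) hy.
- by rewrite l1; exact: homogeneous1.
- by rewrite presalg_lift_gen.
- by rewrite lM; exact: homogeneousM.
Qed.
End Lift.

(** Evaluation kills the ideal of relations, hence factors through the quotient; it
    respects parity because it does so on generators. *)
Lemma presalg_universal (phi : pgen p -> B) :
  (forall g, homogeneous (ppar g) (phi g)) ->
  (forall l r, prel (p := p) l r -> free_eval phi l = free_eval phi r) ->
  exists2 f : presalg p -> B, superalg_hom f &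
    forall g, f (presalg_gen g) = phi g.
Proof.
move=> hp hr; exists (presalg_lift phi); first exact: presalg_lift_hom.
exact: presalg_lift_gen.
Qed.

Lemma presalg_hom_ext (f g : presalg p -> B) :
  superalg_hom f -> superalg_hom g ->
  (forall h, f (presalg_gen h) = g (presalg_gen h)) -> f =1 g.
Proof.
move=> hf hg e x; suff h b y : homogeneous b y -> f y = g y.
  rewrite -[x]hpart_sum (superalg_homD hf) (superalg_homD hg).
  by rewrite !(h _ _ (homogeneous_hpart _ _)).
move: b y; apply: presalg_homogeneous_ind => // [_|_ k y z ey ez||_ _ y z ey ez].
- by rewrite (superalg_hom0 hf) (superalg_hom0 hg).
- by rewrite (superalg_homD hf) (superalg_homD hg) (superalg_homZ hf) (superalg_homZ hg) ey ez.
- by rewrite (superalg_hom1 hf) (superalg_hom1 hg).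
- by rewrite (superalg_homM hf) (superalg_homM hg) ey ez.
Qed.
End PresentedHom.

Section PresentedRelations.
Variables (K : fieldType) (p : presentation K).

Lemma presalg_gen_homogeneous g :
  homogeneous (ppar g) (presalg_gen g : presalg p).
Proof. by rewrite /homogeneous [LHS]presalg_partE fhom_gen. Qed.

(** Evaluating at the generators of the presented algebra is the quotient map; this
    is how the defining relations become equations between generators. *)
Lemma free_eval_presalg_gen u :
  free_eval (@presalg_gen K p) u = lpi (@ideal_gen K p) u.
Proof.
move: u; apply: malg_lin_ind => [|k u v hu hv|m]; first by rewrite !linear0.
  by rewrite linearP presalg_piP -hu -hv.
elim/fmonom_ind: m => [|g m IH]; first exact: free_eval1.
by rewrite -freeUM free_evalM [RHS]presalg_piM IH free_eval_gen.
Qed.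

Lemma presalg_rel l r x y : prel (p := p) l r ->
  free_eval (@presalg_gen K p) l = x -> free_eval (@presalg_gen K p) r = y ->
  x = y.
Proof.
move=> rlr <- <-; rewrite !free_eval_presalg_gen; apply/lpiP; apply: span_gen.
by rewrite -[l - r]mul1r -[_ * _]mulr1; exact: IdealGen.
Qed.
End PresentedRelations.

(** * Universal property of the graded tensor product *)

(** The sign rule that the images of the two factors of a graded tensor product obey. *)
Definition supercommute (K : fieldType) (A B H : superalgType K)
    (al : A -> H) (be : B -> H) :=
  forall a b x y, homogeneous a x -> homogeneous b y ->
    be y * al x = (-1) ^+ (b && a) * (al x * be y).

(** The sign (-1)^(ab) is multiplicative in each parity, so the sign rule passes from
    generators to products, first in one variable and then in the other. *)
Lemma presalg_supercommute (K : fieldType) (p q : presentation K)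
    (H : superalgType K) (al : presalg p -> H) (be : presalg q -> H) :
  superalg_hom al -> superalg_hom be ->
  (forall g h, be (presalg_gen h) * al (presalg_gen g) =
     (-1) ^+ (ppar h && ppar g) * (al (presalg_gen g) * be (presalg_gen h))) ->
  supercommute al be.
Proof.
move=> hal hbe e a b x y hx hy; move: b y hy.
apply: presalg_homogeneous_ind => [b|b k y z ey ez||h|b b' y z ey ez].
- by rewrite (superalg_hom0 hbe) mulr0 mul0r mulr0.
- rewrite (superalg_homD hbe) (superalg_homZ hbe) mulrDl -sscaleAl ey ez.
  by rewrite !mulrDr -!sscaleAr.
- by rewrite (superalg_hom1 hbe) mul1r mulr1 mul1r.
- move: a x hx; apply: presalg_homogeneous_ind => [a|a k x z ex ez||g|a a' x z ex ez].
  + by rewrite (superalg_hom0 hal) mulr0 mul0r mulr0.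
  + rewrite (superalg_homD hal) (superalg_homZ hal) mulrDr -sscaleAr ex ez.
    by rewrite mulrDl mulrDr -sscaleAl -sscaleAr.
  + by rewrite (superalg_hom1 hal) andbF mul1r mulr1 mul1r.
  + exact: e.
  + rewrite (superalg_homM hal) mulrA ex -!mulrA ez andb_addr signr_addb.
    by rewrite (mulrA (al x) ((-1) ^+ _)) (commr_sign (al x)) -!mulrA.
- rewrite (superalg_homM hbe) -mulrA ez (mulrA (be y)) (commr_sign (be y)).
  by rewrite -mulrA (mulrA (be y)) ey andb_addl addbC signr_addb -!mulrA.
Qed.

Section TensorHom.
Variables (K : fieldType) (A B : superalgType K).
Local Notation T := (tensor A B).

Lemma tensNl (x : A) (y : B) : - x ⊗ y = - (x ⊗ y) :> T.
Proof. by apply: (addrI (x ⊗ y)); rewrite -tensDl !subrr tens0l. Qed.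

Lemma tensNr (x : A) (y : B) : x ⊗ - y = - (x ⊗ y) :> T.
Proof. by apply: (addrI (x ⊗ y)); rewrite -tensDr !subrr tens0r. Qed.

(** The parts of x' of both parities pass the factor 1 without a sign. *)
Lemma tens_mull (x x' : A) (y' : B) : (x ⊗ 1) * (x' ⊗ y') = (x * x') ⊗ y' :> T.
Proof.
rewrite -[x']hpart_sum mulrDr !tensDl mulrDr.
by rewrite !(tensM x y' (homogeneous1 B) (homogeneous_hpart _ x')) !sscale1 mul1r.
Qed.

Lemma tens_mulr (x : A) (y y' : B) : (x ⊗ y) * (1 ⊗ y') = x ⊗ (y * y') :> T.
Proof.
rewrite -[y]hpart_sum mulrDl !tensDr mulrDl.
rewrite !(tensM x y' (homogeneous_hpart _ y) (homogeneous1 A)) !andbF.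
by rewrite !sscale1 mulr1.
Qed.

Lemma tens_factor (x : A) (y : B) : x ⊗ y = (x ⊗ 1) * (1 ⊗ y) :> T.
Proof. by rewrite tens_mull mulr1. Qed.

Lemma homogeneous_tens a b (x : A) (y : B) :
  homogeneous a x -> homogeneous b y -> homogeneous (a (+) b) (x ⊗ y : T).
Proof. by move=> hx hy; rewrite /homogeneous [LHS](tensor_part_homog _ hx hy) eqxx. Qed.

Lemma tens_inl_hom : superalg_hom (fun x : A => x ⊗ 1 : T).
Proof.
split=> [x y||k x|b x hx].
- by rewrite tensDl tensNl.
- by split=> // x y; rewrite /= tens_mull.
- by rewrite tensZl sscale_tensor.
- by rewrite -[b]addbF; exact: homogeneous_tens hx (homogeneous1 _).
Qed.

Lemma tens_inr_hom : superalg_hom (fun y : B => 1 ⊗ y : T).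
Proof.
split=> [x y||k x|b x hx].
- by rewrite tensDr tensNr.
- by split=> // x y; rewrite /= tens_mulr.
- by rewrite tensZr sscale_tensor.
- exact: homogeneous_tens (homogeneous1 _) hx.
Qed.

Lemma tens_inl_inr a b (x : A) (y : B) : homogeneous a x -> homogeneous b y ->
  (1 ⊗ y) * (x ⊗ 1) = (-1) ^+ (b && a) * ((x ⊗ 1) * (1 ⊗ y)) :> T.
Proof.
move=> hx hy; rewrite (tensM 1 1 hy hx) -tens_factor !mul1r !mulr1.
exact: sscale_sign.
Qed.

(** Every pure tensor is a product of elements of the two factors. *)
Lemma tensor_hom_ext (H : superalgType K) (f g : T -> H) :
  superalg_hom f -> superalg_hom g ->
  (forall x, f (x ⊗ 1) = g (x ⊗ 1)) -> (forall y, f (1 ⊗ y) = g (1 ⊗ y)) ->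
  f =1 g.
Proof.
move=> hf hg el er; apply: tensor_ind => [t u et eu|a b x y _ _].
  by rewrite (superalg_homD hf) (superalg_homD hg) et eu.
by rewrite tens_factor (superalg_homM hf) (superalg_homM hg) el er.
Qed.

(** The map x ⊗ y to al x * be y is bilinear, so it extends to the tensor product;
    the sign that the product of the tensor product introduces is the one that
    exchanging be y and al x' costs. *)
Lemma tensor_universal (H : superalgType K) (al : A -> H) (be : B -> H) :
  superalg_hom al -> superalg_hom be -> supercommute al be ->
  exists f : T -> H, [/\ superalg_hom f, forall x, f (x ⊗ 1) = al x &
    forall y, f (1 ⊗ y) = be y].
Proof.
move=> hal hbe hc.
pose m (x : A) (y : B) : slmod H := al x * be y.
have bm : bilinear_map m.
  split=> [x x' y|x y y'|k x y|k x y]; rewrite /m.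
  - by rewrite (superalg_homD hal) mulrDl.
  - by rewrite (superalg_homD hbe) mulrDr.
  - by rewrite (superalg_homZ hal) -sscaleAl.
  - by rewrite (superalg_homZ hbe) -sscaleAr.
pose f : T -> H := tlift m.
have fE x y : f (x ⊗ y) = al x * be y by exact: tlift_tens bm.
have fP k t u : f (k *: t + u) = k ∙ f t + f u by exact: tlift_linear bm k t u.
have fD t u : f (t + u) = f t + f u by rewrite -[t]scale1r fP sscale1 scale1r.
have fB t u : f (t - u) = f t - f u.
  by rewrite addrC -scaleN1r fP sscaleNl sscale1 addrC.
have f0 : f 0 = 0 by rewrite -(subrr 0) fB subrr.
have fZ k t : f (k ∙ t) = k ∙ f t by rewrite sscale_tensor -[_ *: _]addr0 fP f0 addr0.
exists f; split=> [|x|y]; last 2 first.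
- by rewrite fE (superalg_hom1 hbe) mulr1.
- by rewrite fE (superalg_hom1 hal) mul1r.
split=> //.
- split=> [|t u]; first by rewrite fE (superalg_hom1 hal) (superalg_hom1 hbe) mulr1.
  move: t; apply: tensor_ind => [t t' et et'|a b x y hx hy].
    by rewrite mulrDl !fD et et' mulrDl.
  move: u; apply: tensor_ind => [t t' et et'|a' b' x' y' hx' hy'].
    by rewrite mulrDr !fD et et' mulrDr.
  rewrite (tensM x y' hy hx') fZ !fE (superalg_homM hal) (superalg_homM hbe).
  rewrite sscale_sign -[RHS]mulrA (mulrA (be y)) (hc _ _ _ _ hx' hy).
  by rewrite !mulrA (commr_sign (al x)) -!mulrA.
- move=> b t ht; rewrite -ht; move: t {ht}.
  apply: tensor_ind => [t u et eu|a c x y hx hy].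
    by rewrite raddfD /= fD; exact: homogeneousD.
  rewrite [hpart b _](tensor_part_homog b hx hy); case: eqP => [->|_].
    rewrite fE; apply: homogeneousM.
      exact: superalg_hom_homogeneous hal _ _ hx.
    exact: superalg_hom_homogeneous hbe _ _ hy.
  by rewrite f0; exact: homogeneous0.
Qed.

End TensorHom.

(** * Clifford differences and the two sets of relations *)

(** Interchange of the two middle factors: the shape of almost every computation
    below, where (x * y) and (z * w) are a Clifford factor times another factor. *)
Lemma mulrACA_comm (A : pzRingType) (x y z w y' z' : A) :
  y * z = z' * y' -> (x * y) * (z * w) = (x * z') * (y' * w).
Proof. by move=> e; rewrite !mulrA -(mulrA x y z) e !mulrA. Qed.

Lemma mulrACA_anti (A : pzRingType) (x y z w : A) :
  y * z = - (z * y) -> (x * y) * (z * w) = - ((x * z) * (y * w)).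
Proof. by move=> e; rewrite !mulrA -(mulrA x y z) e mulrN !mulNr !mulrA. Qed.

(** Up to the factor sqrt 2, the lift of the simple transposition to the Pin group,
    that is, the reflection vector c_i - c_(i+1) in the Clifford algebra. *)
Definition clifford_diff (A : pzRingType) n (c : 'I_n -> A) (i : 'I_n.-1) : A :=
  c (ord_lo i) - c (ord_hi i).

Section CliffordDifferences.
Variables (A : pzRingType) (n : nat) (c : 'I_n -> A).
Hypothesis c_sq : forall i, c i * c i = 1.
Hypothesis c_anti : forall i j, i != j -> c i * c j = - (c j * c i).
Local Notation D := (clifford_diff c).
Local Notation s i := (simple_transp i).

(** Conjugation by a vector of the Clifford algebra is minus the reflection in it, and
    the reflection in c_i - c_(i+1) exchanges i and i+1. *)
Lemma clifford_diff_c i k : D i * c k = - (c (s i k) * D i).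
Proof.
rewrite /clifford_diff mulrBl mulrBr opprB.
case: (eqVneq k (ord_lo i)) => [->|kl]; first by rewrite simple_transp_lo !c_sq.
case: (eqVneq k (ord_hi i)) => [->|kh]; first by rewrite simple_transp_hi !c_sq.
by rewrite simple_transp_other // (c_anti kl) (c_anti kh) opprK addrC.
Qed.

Lemma clifford_diff_sq i : D i * D i = 1 *+ 2.
Proof.
rewrite /clifford_diff mulrBl !mulrBr !c_sq (c_anti (ord_lo_neq_hi i)).
by rewrite opprK opprB addrACA subrr addr0.
Qed.

Lemma clifford_diff_anti (i j : 'I_n.-1) : (i.+1 < j)%N -> D i * D j = - (D j * D i).
Proof.
move=> lt; rewrite [clifford_diff c j]/clifford_diff mulrBr mulrBl.
have [lo hi] : s i (ord_lo j) = ord_lo j /\ s i (ord_hi j) = ord_hi j.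
  by split; apply: simple_transp_other; rewrite -val_eqE /=; lia.
by rewrite !clifford_diff_c lo hi opprB opprK addrC.
Qed.

Lemma clifford_diff_triple i j :
  D i * (D i + D j) * D j = D j * (D i + D j) * D i.
Proof.
move: (clifford_diff_sq i) (clifford_diff_sq j); move: (D i) (D j) => x y ex ey.
rewrite !mulrDr !mulrDl -(mulrA x y y) -(mulrA y x x) ex ey.
by rewrite !mulrnAl !mulrnAr !mul1r !mulr1 addrC.
Qed.

Section Adjacent.
Variables (i j : 'I_n.-1).
Hypothesis e : j = i.+1 :> nat.

Lemma clifford_diff_add : D i + D j = c (ord_lo i) - c (ord_hi j).
Proof. by rewrite /clifford_diff (ord_lo_adjacent e) addrA subrK. Qed.

Lemma clifford_diff_adjacent : D i * D j = - (1 *+ 2) - D j * D i.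
Proof.
rewrite {2}/clifford_diff mulrBr !clifford_diff_c (ord_lo_adjacent e) simple_transp_hi.
rewrite (simple_transp_adjacent_hi e) opprK -(clifford_diff_sq i) -opprD -mulrDl.
by rewrite clifford_diff_add mulrBl opprB addrC.
Qed.

(** With x y + y x = - 2 and x^2 = y^2 = 2, both sides are - 2 (x + y). *)
Lemma clifford_diff_braid : D i * D j * D i = D j * D i * D j.
Proof.
move: clifford_diff_adjacent (clifford_diff_sq i) (clifford_diff_sq j).
(* Generalized, since matching a difference would unfold D i. *)
move: (D i) (D j) => x y exy ex ey.
rewrite -[RHS]mulrA exy mulrBl mulrBr mulNr mulrN -mulrA ex mulrA ey.
by rewrite !mulrnAl !mulrnAr !mul1r !mulr1 addrC.
Qed.
End Adjacent.
End CliffordDifferences.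

Section SqrtMinusTwo.
Variables (K : fieldType) (r : K).
Hypotheses (r_sq : r ^+ 2 = - 2) (nz2 : 2 != 0 :> K).

Lemma sqrtN2_neq0 : r != 0.
Proof. by have := oppr_eq0 (2 : K); rewrite -r_sq expf_eq0 /= => ->. Qed.

Lemma sqrtN2_inv_sq : r^-1 * r^-1 *+ 2 = -1.
Proof. by rewrite -mulr_natr -invfM -expr2 r_sq invrN mulNr mulVf. Qed.

Variable A : superalgType K.

Lemma sqrtN2_inv_sqZ (x : A) : (r^-1 * r^-1) ∙ (x *+ 2) = - x.
Proof. by rewrite sscale_nat sqrtN2_inv_sq sscaleNl sscale1. Qed.

Variables (n : nat).
Local Notation s i := (simple_transp i).

(** The two round trips on a generator: a product of two equal Clifford factors is a
    scalar, which the powers of the square root of - 2 cancel. *)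
Section RoundTrips.
Variable c : 'I_n -> A.
Hypothesis c_sq : forall i, c i * c i = 1.
Hypothesis c_anti : forall i j, i != j -> c i * c j = - (c j * c i).

Lemma clifford_scale_cancel (k l : K) i (x : A) :
  k * l = 1 -> k ∙ (c i * (l ∙ (c i * x))) = x.
Proof. by move=> kl; rewrite -sscaleAr sscaleA kl sscale1 mulrA c_sq mul1r. Qed.

Lemma clifford_diff_cancel i (x : A) :
  r^-1 ∙ (clifford_diff c i * (r^-1 ∙ ((c (ord_hi i) - c (ord_lo i)) * x))) = x.
Proof.
rewrite -sscaleAr sscaleA -[c (ord_hi i) - _]opprB mulNr mulrN mulrA.
by rewrite (clifford_diff_sq c_sq c_anti) mulrnAl mul1r sscaleN sqrtN2_inv_sqZ opprK.
Qed.

Lemma clifford_diffN_cancel i (x : A) :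
  r^-1 ∙ ((c (ord_hi i) - c (ord_lo i)) * (r^-1 ∙ (clifford_diff c i * x))) = x.
Proof.
rewrite -[c (ord_hi i) - _]opprB mulNr -sscaleAr sscaleN sscaleA mulrA.
by rewrite (clifford_diff_sq c_sq c_anti) mulrnAl mul1r sqrtN2_inv_sqZ opprK.
Qed.
End RoundTrips.

(** Inside any superalgebra, the Hecke-Clifford relations from the Clifford and the
    spin relations when the two families of generators anticommute. *)
Section ToHecke.
Variables (c b : 'I_n -> A) (t : 'I_n.-1 -> A).
Hypothesis c_sq : forall i, c i * c i = 1.
Hypothesis c_anti : forall i j, i != j -> c i * c j = - (c j * c i).
Hypothesis t_sq : forall i, t i * t i = 1.
Hypothesis t_braid : forall i j : 'I_n.-1, j = i.+1 :> nat ->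
  t i * t j * t i = t j * t i * t j.
Hypothesis t_anti : forall i j : 'I_n.-1, (i.+1 < j)%N -> t i * t j = - (t j * t i).
Hypothesis b_anti : forall i j, i != j -> b i * b j = - (b j * b i).
Hypothesis b_affine : forall i, b (ord_hi i) * t i = - (t i * b (ord_lo i)) + 1.
Hypothesis tb_anti : forall (j : 'I_n.-1) (i : 'I_n),
  i != ord_lo j -> i != ord_hi j -> t j * b i = - (b i * t j).
Hypothesis bc : forall i j, b i * c j = - (c j * b i).
Hypothesis tc : forall i j, t i * c j = - (c j * t i).

Local Notation D := (clifford_diff c).
Definition hecke_a i : A := r ∙ (c i * b i).
Definition hecke_s i : A := r^-1 ∙ (D i * t i).
Local Notation a := hecke_a.
Local Notation S := hecke_s.

Lemma t_diff i j : t i * D j = - (D j * t i).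
Proof. by rewrite /clifford_diff mulrBr mulrBl !tc opprB opprK addrC. Qed.

Lemma b_diff i j : b i * D j = - (D j * b i).
Proof. by rewrite /clifford_diff mulrBr mulrBl !bc opprB opprK addrC. Qed.

Lemma hecke_s_sq i : S i * S i = 1.
Proof.
rewrite sscaleM (mulrACA_anti _ _ (t_diff i i)) t_sq mulr1 (clifford_diff_sq c_sq c_anti).
by rewrite sscaleN sqrtN2_inv_sqZ opprK.
Qed.

(** Moving the Clifford factors to the left costs the same sign on both sides and
    leaves the braid relation of the differences next to that of the t_i. *)
Lemma hecke_s_braid (i j : 'I_n.-1) : j = i.+1 :> nat -> S i * S j * S i = S j * S i * S j.
Proof.
move=> e; rewrite !sscaleM.
rewrite (mulrACA_anti _ _ (t_diff i j)) (mulrACA_anti _ _ (t_diff j i)) !mulNr.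
have comm k l m : t k * t l * D m = D m * (t k * t l).
  by rewrite -mulrA t_diff mulrN mulrA t_diff mulNr opprK mulrA.
rewrite !(mulrACA_comm _ _ (comm _ _ _)).
by rewrite (clifford_diff_braid c_sq c_anti e) (t_braid e).
Qed.

Lemma hecke_s_comm (i j : 'I_n.-1) : (i.+1 < j)%N -> S i * S j = S j * S i.
Proof.
move=> lt; rewrite !sscaleM.
rewrite (mulrACA_anti _ _ (t_diff i j)) (mulrACA_anti _ _ (t_diff j i)).
by rewrite (clifford_diff_anti c_sq c_anti lt) (t_anti lt) mulrNN.
Qed.

Lemma hecke_s_c i k : S i * c k = c (s i k) * S i.
Proof.
rewrite -sscaleAl -sscaleAr -mulrA tc mulrN mulrA.
by rewrite (clifford_diff_c c_sq c_anti) mulNr opprK mulrA.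
Qed.

Lemma hecke_as i k : k != ord_lo i -> k != ord_hi i -> a k * S i = S i * a k.
Proof.
move=> kl kh; rewrite !sscaleM mulrC.
rewrite (mulrACA_anti _ _ (b_diff k i)) (mulrACA_anti _ _ (tc i k)).
by rewrite (clifford_diff_c c_sq c_anti) (tb_anti kl kh) simple_transp_other // mulrNN.
Qed.

(** Both products contain c_(i+1) (c_i - c_(i+1)) on the left, and the remaining
    factors sum to 1 by the affine relation of the spin side. *)
Lemma hecke_affine i : a (ord_hi i) * S i - S i * a (ord_lo i)
  = 1 - c (ord_hi i) * c (ord_lo i).
Proof.
rewrite !sscaleM mulfV ?mulVf ?sqrtN2_neq0 // !sscale1.
rewrite (mulrACA_anti _ _ (b_diff _ i)) (mulrACA_anti _ _ (tc i _)).
rewrite (clifford_diff_c c_sq c_anti) simple_transp_lo mulNr opprK -opprD -mulrDr.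
by rewrite b_affine addrC addrA subrr add0r mulr1 mulrBr c_sq opprB.
Qed.

Lemma hecke_ca i : c i * a i = - (a i * c i).
Proof. by rewrite -sscaleAl -sscaleAr -sscaleN -mulrA bc mulrN opprK. Qed.

Lemma hecke_aa i j : a i * a j = a j * a i.
Proof.
have [->//|ne] := eqVneq i j.
rewrite !sscaleM (mulrACA_anti _ _ (bc i j)) (mulrACA_anti _ _ (bc j i)).
by rewrite (c_anti ne) (b_anti ne) mulrNN.
Qed.

Lemma hecke_ca_comm i j : i != j -> c j * a i = a i * c j.
Proof.
move=> ne; rewrite -sscaleAl -sscaleAr -mulrA bc mulrN !mulrA.
by rewrite (c_anti ne) mulNr opprK.
Qed.
End ToHecke.

(** Conversely, the spin relations from the Hecke-Clifford ones; the simple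
    transpositions permute the Clifford generators, and twisting by the Clifford
    differences turns this action into anticommutation. *)
Section ToSpin.
Variables (c a : 'I_n -> A) (S : 'I_n.-1 -> A).
Hypothesis c_sq : forall i, c i * c i = 1.
Hypothesis c_anti : forall i j, i != j -> c i * c j = - (c j * c i).
Hypothesis S_sq : forall i, S i * S i = 1.
Hypothesis S_braid : forall i j : 'I_n.-1, j = i.+1 :> nat ->
  S i * S j * S i = S j * S i * S j.
Hypothesis S_comm : forall i j : 'I_n.-1, (i.+1 < j)%N -> S i * S j = S j * S i.
Hypothesis S_c : forall i k, S i * c k = c (s i k) * S i.
Hypothesis a_s : forall i k, k != ord_lo i -> k != ord_hi i -> a k * S i = S i * a k.
Hypothesis a_affine : forall i, a (ord_hi i) * S i - S i * a (ord_lo i)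
  = 1 - c (ord_hi i) * c (ord_lo i).
Hypothesis ca : forall i, c i * a i = - (a i * c i).
Hypothesis aa : forall i j, a i * a j = a j * a i.
Hypothesis ca_comm : forall i j, i != j -> c j * a i = a i * c j.

Local Notation D := (clifford_diff c).
Definition spin_b i : A := r^-1 ∙ (c i * a i).
Definition spin_t i : A := r^-1 ∙ ((c (ord_hi i) - c (ord_lo i)) * S i).
Local Notation b := spin_b.
Local Notation t := spin_t.

(** The sign moves to the scalar, so that both directions use the same differences. *)
Lemma spin_tE i : t i = (- r^-1) ∙ (D i * S i).
Proof. by rewrite /spin_t -opprB mulNr sscaleN sscaleNl. Qed.

Lemma S_diff i : S i * D i = - (D i * S i).
Proof.
by rewrite /clifford_diff mulrBr !S_c simple_transp_lo simple_transp_hi -mulrBl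
  -[RHS]mulNr opprB.
Qed.

Lemma S_diff_far (i j : 'I_n.-1) : (i.+1 < j)%N || (j.+1 < i)%N -> S i * D j = D j * S i.
Proof.
move=> lt; rewrite /clifford_diff mulrBr mulrBl !S_c.
by rewrite !(@simple_transp_other _ i) //; rewrite -val_eqE /=; move: lt; clear; lia.
Qed.

Lemma spin_t_sq i : t i * t i = 1.
Proof.
rewrite !spin_tE sscaleM (mulrACA_anti _ _ (S_diff i)) S_sq mulr1.
by rewrite (clifford_diff_sq c_sq c_anti) mulrNN sscaleN sqrtN2_inv_sqZ opprK.
Qed.

(** Here s_i exchanges D j and D i + D j, and s_j exchanges D i and D i + D j. Moving
    every transposition to the right leaves D i (D i + D j) D j on one side and its
    reversal on the other, and these agree. *)
Lemma spin_t_braid (i j : 'I_n.-1) : j = i.+1 :> nat -> t i * t j * t i = t j * t i * t j.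
Proof.
move=> e; rewrite !spin_tE !sscaleM.
have el := ord_lo_adjacent e.
have il := simple_transp_lo i; have ih := simple_transp_hi i.
have jl := simple_transp_lo j; have jh := simple_transp_hi j.
have ij := simple_transp_adjacent_lo e; have ji := simple_transp_adjacent_hi e.
have iD : S i * D j = (D i + D j) * S i.
  by rewrite (clifford_diff_add c e) /clifford_diff mulrBr !S_c el ih ji mulrBl.
have jD : S j * D i = (D i + D j) * S j.
  by rewrite (clifford_diff_add c e) /clifford_diff mulrBr !S_c -el jl ij mulrBl.
have iE : S i * (D i + D j) = D j * S i.
  by rewrite (clifford_diff_add c e) /clifford_diff mulrBr !S_c il ji el mulrBl.
have jE : S j * (D i + D j) = D i * S j.
  by rewrite (clifford_diff_add c e) /clifford_diff mulrBr !S_c ij jh el mulrBl.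
have iji : S i * S j * D i = D j * (S i * S j).
  by rewrite -mulrA jD mulrA iE mulrA.
have jij : S j * S i * D j = D i * (S j * S i).
  by rewrite -mulrA iD mulrA jE mulrA.
have step k l : S k * D l = (D i + D j) * S k -> S k * S l * D k = D l * (S k * S l) ->
    D k * S k * (D l * S l) * (D k * S k) =
    D k * (D i + D j) * D l * (S k * S l * S k).
  move=> e1 e2; rewrite -(mulrA (D k)) (mulrA (S k)) e1 -(mulrA _ (S k)) (mulrA (D k)).
  by rewrite (mulrACA_comm _ _ e2).
by rewrite (step _ _ iD iji) (step _ _ jD jij) (clifford_diff_triple c_sq c_anti i j) S_braid.
Qed.

Lemma spin_t_anti (i j : 'I_n.-1) : (i.+1 < j)%N -> t i * t j = - (t j * t i).
Proof.
move=> lt; rewrite !spin_tE !sscaleM -sscaleN.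
rewrite (mulrACA_comm _ _ (S_diff_far (i := i) (j := j) _)) ?lt //.
rewrite (mulrACA_comm _ _ (S_diff_far (i := j) (j := i) _)) ?lt ?orbT //.
by rewrite (clifford_diff_anti c_sq c_anti lt) (S_comm lt) (mulNr (D j * D i)).
Qed.

Lemma spin_b_anti i j : i != j -> b i * b j = - (b j * b i).
Proof.
move=> ne; rewrite !sscaleM -sscaleN.
rewrite (mulrACA_comm _ _ (esym (ca_comm ne))).
have ne' : j != i by rewrite eq_sym.
rewrite (mulrACA_comm _ _ (esym (ca_comm ne'))).
by rewrite (c_anti ne) aa mulNr.
Qed.

(** With e = c_(i+1) c_i, of square - 1, the two terms are multiples of
    (1 + e) a_(i+1) s_i and (1 + e) s_i a_i. Their difference is (1 + e) (1 - e) = 2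
    by the affine relation, and the scalar (1 / r) (- 1 / r) = 1/2 turns it into 1. *)
Lemma spin_affine i : b (ord_hi i) * t i = - (t i * b (ord_lo i)) + 1.
Proof.
have hl : ord_hi i != ord_lo i by rewrite eq_sym ord_lo_neq_hi.
set l := ord_lo i; set h := ord_hi i; set e := c h * c l.
have ee : e * e = -1.
  by rewrite /e (mulrACA_anti _ _ (c_anti (ord_lo_neq_hi i))) !c_sq mulr1.
have aD : a h * D i = (c l + c h) * a h.
  by rewrite /clifford_diff mulrBr mulrDl ca -(ca_comm hl).
have e1 : (c h * a h) * (D i * S i) = (1 + e) * (a h * S i).
  by rewrite -(mulrA (c h)) (mulrA (a h)) aD !mulrA mulrDr c_sq addrC.
have e2 : (D i * S i) * (c l * a l) = - ((1 + e) * (S i * a l)).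
  have cD : c l * D i = 1 + e.
    by rewrite /clifford_diff mulrBr c_sq (c_anti (ord_lo_neq_hi i)) opprK.
  rewrite -(mulrA (D i)) (mulrA (S i)) S_c simple_transp_lo -(mulrA (c _)).
  by rewrite (mulrA (D i)) (clifford_diff_c c_sq c_anti) simple_transp_hi cD mulNr.
have e12 : (1 + e) * (1 - e) = 1 *+ 2.
  by rewrite mulrBr mulr1 mulrDl mul1r ee opprD opprK addrA addrK.
have aS : a h * S i = S i * a l + (1 - e) by rewrite -a_affine addrC subrK.
rewrite !spin_tE !sscaleM e1 e2 aS mulrDr e12 mulrN mulNr !sscaleNl sscaleN.
by rewrite opprK sscaleDr opprD sqrtN2_inv_sqZ opprK.
Qed.

Lemma spin_tb_anti (j : 'I_n.-1) (i : 'I_n) :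
  i != ord_lo j -> i != ord_hi j -> t j * b i = - (b i * t j).
Proof.
move=> il ih; rewrite !spin_tE !sscaleM -sscaleN mulrC.
have Sc : S j * c i = c i * S j by rewrite S_c simple_transp_other.
have aD : a i * D j = D j * a i.
  by rewrite /clifford_diff mulrBr mulrBl -!ca_comm // eq_sym.
rewrite (mulrACA_comm _ _ Sc) (mulrACA_comm _ _ aD) -(a_s il ih).
by rewrite (clifford_diff_c c_sq c_anti) simple_transp_other // mulNr.
Qed.

Lemma spin_bc i j : b i * c j = - (c j * b i).
Proof.
rewrite -sscaleAl -sscaleAr -sscaleN; congr (_ ∙ _).
have [->|ne] := eqVneq i j; first by rewrite {1}ca mulNr -mulrA c_sq mulr1 mulrA c_sq mul1r.
by rewrite -mulrA -(ca_comm ne) !mulrA (c_anti ne) mulNr.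
Qed.

Lemma spin_tc i j : t i * c j = - (c j * t i).
Proof.
rewrite !spin_tE -sscaleAl -sscaleAr -sscaleN -mulrA S_c mulrA.
by rewrite (clifford_diff_c c_sq c_anti) tpermK mulNr mulrA.
Qed.
End ToSpin.
End SqrtMinusTwo.

(** * The isomorphism *)

Lemma eq_through (X : Type) (u v x y : X) : u = x -> v = y -> x = y -> u = v.
Proof. by move=> -> -> ->. Qed.

Section Isomorphism.
Variables (K : fieldType) (r : K) (n : nat).
Hypotheses (r_sq : r ^+ 2 = - 2) (nz2 : 2 != 0 :> K).
Local Notation s i := (simple_transp i).

Local Notation Cl := (clifford K n).
Local Notation Hc := (hecke_clifford K n).
Local Notation Hm := (spin_hecke K n).
Local Notation c := (Cl_c K).
Local Notation b := (Hm_b K).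
Local Notation t := (Hm_t K).

(** The defining relations are transported to the generators of the three algebras by
    evaluating their two sides. *)
Lemma Cl_rel l r' x y : clifford_rel l r' ->
  free_eval (@Cl_c K n) l = x -> free_eval (@Cl_c K n) r' = y -> x = y.
Proof. exact: (presalg_rel (p := Presentation (@clifford_homogeneous K n))). Qed.

Lemma Hm_rel l r' x y : hm_rel l r' ->
  free_eval (@Hm_gen K n) l = x -> free_eval (@Hm_gen K n) r' = y -> x = y.
Proof. exact: (presalg_rel (p := Presentation (@hm_homogeneous K n))). Qed.

Lemma Hc_rel l r' x y : hc_rel l r' ->
  free_eval (@Hc_gen K n) l = x -> free_eval (@Hc_gen K n) r' = y -> x = y.
Proof. exact: (presalg_rel (p := Presentation (@hc_homogeneous K n))). Qed.

Local Notation eg := (free_eval_gen _ _).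
Local Notation "x ** y" := (free_eval_mul x y) (at level 40, left associativity).
Local Notation e1 := (free_eval1 _).
Local Notation opp := free_eval_opp.
Local Notation add := free_eval_add.

Lemma Cl_c_sq i : c i * c i = 1 :> Cl.
Proof. exact: Cl_rel (Cl_cc K i) (eg ** eg) e1. Qed.

Lemma Cl_c_anti i j : i != j -> c i * c j = - (c j * c i) :> Cl.
Proof. by move=> ne; exact: Cl_rel (Cl_cc_anti K ne) (eg ** eg) (opp (eg ** eg)). Qed.

Lemma Hm_t_sq i : t i * t i = 1 :> Hm.
Proof. exact: Hm_rel (Hm_tt K i) (eg ** eg) e1. Qed.

Lemma Hm_t_braid (i j : 'I_n.-1) : j = i.+1 :> nat ->
  t i * t j * t i = t j * t i * t j :> Hm.
Proof. by move=> e; exact: Hm_rel (Hm_braid K e) (eg ** eg ** eg) (eg ** eg ** eg). Qed.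

Lemma Hm_t_anti (i j : 'I_n.-1) : (i.+1 < j)%N -> t i * t j = - (t j * t i) :> Hm.
Proof.
move=> lt; have lt' : (i.+1 < j)%N || (j.+1 < i)%N by rewrite lt.
exact: Hm_rel (Hm_tt_anti K lt') (eg ** eg) (opp (eg ** eg)).
Qed.

Lemma Hm_b_anti i j : i != j -> b i * b j = - (b j * b i) :> Hm.
Proof. by move=> ne; exact: Hm_rel (Hm_bb_anti K ne) (eg ** eg) (opp (eg ** eg)). Qed.

Lemma Hm_affine i : b (ord_hi i) * t i = - (t i * b (ord_lo i)) + 1 :> Hm.
Proof. exact: Hm_rel (Hm_bt_affine K i) (eg ** eg) (add (opp (eg ** eg)) e1). Qed.

Lemma Hm_t_b (j : 'I_n.-1) i : i != ord_lo j -> i != ord_hi j ->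
  t j * b i = - (b i * t j) :> Hm.
Proof. by move=> l h; exact: Hm_rel (Hm_tb_anti K l h) (eg ** eg) (opp (eg ** eg)). Qed.

Local Notation sg := (Hc_sigma K).
Local Notation a := (Hc_a K).
Local Notation d := (Hc_c K).
Local Notation S := (Hc_s K).

Lemma Hc_sigma_1 : sg 1%g = 1 :> Hc.
Proof. exact: Hc_rel (Hc_sigma1 K n) eg e1. Qed.

Lemma Hc_sigma_mul (u w : 'S_n) : sg (u * w)%g = sg w * sg u :> Hc.
Proof. by apply/esym; exact: Hc_rel (Hc_sigmaM K w u) (eg ** eg) eg. Qed.

Lemma Hc_sigma_c (w : 'S_n) i : sg w * d i = d (w i) * sg w :> Hc.
Proof. exact: Hc_rel (Hc_sigmac K w i) (eg ** eg) (eg ** eg). Qed.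

Lemma Hc_c_sq i : d i * d i = 1 :> Hc.
Proof. exact: Hc_rel (Hc_cc K i) (eg ** eg) e1. Qed.

Lemma Hc_c_anti i j : i != j -> d i * d j = - (d j * d i) :> Hc.
Proof. by move=> ne; exact: Hc_rel (Hc_cc_anti K ne) (eg ** eg) (opp (eg ** eg)). Qed.

Lemma Hc_a_s i j : j != ord_lo i -> j != ord_hi i -> a j * S i = S i * a j :> Hc.
Proof. by move=> l h; exact: Hc_rel (Hc_as K l h) (eg ** eg) (eg ** eg). Qed.

Lemma Hc_affine i : a (ord_hi i) * S i - S i * a (ord_lo i)
  = 1 - d (ord_hi i) * d (ord_lo i) :> Hc.
Proof.
exact: Hc_rel (Hc_as_affine K i) (add (eg ** eg) (opp (eg ** eg))) (add e1 (opp (eg ** eg))).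
Qed.

Lemma Hc_c_a i : d i * a i = - (a i * d i) :> Hc.
Proof. exact: Hc_rel (Hc_ca K i) (eg ** eg) (opp (eg ** eg)). Qed.

Lemma Hc_a_a i j : a i * a j = a j * a i :> Hc.
Proof. exact: Hc_rel (Hc_aa K i j) (eg ** eg) (eg ** eg). Qed.

Lemma Hc_c_a_comm i j : i != j -> d j * a i = a i * d j :> Hc.
Proof. by move=> ne; exact: Hc_rel (Hc_ca_comm K ne) (eg ** eg) (eg ** eg). Qed.

Lemma Hc_s_sq i : S i * S i = 1 :> Hc.
Proof. by rewrite /Hc_s -Hc_sigma_mul simple_transpK Hc_sigma_1. Qed.

Lemma Hc_s_braid (i j : 'I_n.-1) : j = i.+1 :> nat ->
  S i * S j * S i = S j * S i * S j :> Hc.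
Proof. by move=> e; rewrite /Hc_s -!Hc_sigma_mul !mulgA simple_transp_braid. Qed.

Lemma Hc_s_comm (i j : 'I_n.-1) : (i.+1 < j)%N -> S i * S j = S j * S i :> Hc.
Proof. by move=> lt; rewrite /Hc_s -!Hc_sigma_mul (simple_transp_comm lt). Qed.

Local Notation T := (tensor Cl Hm).
Definition tens_c i : T := c i ⊗ 1.
Definition tens_b i : T := 1 ⊗ b i.
Definition tens_t i : T := 1 ⊗ t i.

Lemma Cl_c_homogeneous i : homogeneous true (c i : Cl).
Proof. exact: (presalg_gen_homogeneous (p := Presentation (@clifford_homogeneous K n))). Qed.

Lemma Hm_gen_homogeneous x : homogeneous true (Hm_gen K x : Hm).
Proof. exact: (presalg_gen_homogeneous (p := Presentation (@hm_homogeneous K n))). Qed.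

Lemma tens_c_sq i : tens_c i * tens_c i = 1.
Proof. by rewrite /tens_c tens_mull Cl_c_sq. Qed.

Lemma tens_c_anti i j : i != j -> tens_c i * tens_c j = - (tens_c j * tens_c i).
Proof. by move=> ne; rewrite /tens_c !tens_mull (Cl_c_anti ne) tensNl. Qed.

Lemma tens_t_sq i : tens_t i * tens_t i = 1.
Proof. by rewrite /tens_t tens_mulr Hm_t_sq. Qed.

Lemma tens_t_braid (i j : 'I_n.-1) : j = i.+1 :> nat ->
  tens_t i * tens_t j * tens_t i = tens_t j * tens_t i * tens_t j.
Proof. by move=> e; rewrite /tens_t !tens_mulr (Hm_t_braid e). Qed.

Lemma tens_t_anti (i j : 'I_n.-1) : (i.+1 < j)%N -> tens_t i * tens_t j = - (tens_t j * tens_t i).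
Proof. by move=> lt; rewrite /tens_t !tens_mulr (Hm_t_anti lt) tensNr. Qed.

Lemma tens_b_anti i j : i != j -> tens_b i * tens_b j = - (tens_b j * tens_b i).
Proof. by move=> ne; rewrite /tens_b !tens_mulr (Hm_b_anti ne) tensNr. Qed.

Lemma tens_affine i : tens_b (ord_hi i) * tens_t i = - (tens_t i * tens_b (ord_lo i)) + 1.
Proof. by rewrite /tens_b /tens_t !tens_mulr Hm_affine tensDr tensNr. Qed.

Lemma tens_t_b (j : 'I_n.-1) i : i != ord_lo j -> i != ord_hi j ->
  tens_t j * tens_b i = - (tens_b i * tens_t j).
Proof. by move=> l h; rewrite /tens_b /tens_t !tens_mulr (Hm_t_b l h) tensNr. Qed.

Lemma tens_spin_c x i : (1 ⊗ Hm_gen K x : T) * tens_c i = - (tens_c i * (1 ⊗ Hm_gen K x)).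
Proof.
rewrite (tens_inl_inr (Cl_c_homogeneous i) (Hm_gen_homogeneous x)).
by rewrite expr1 mulN1r.
Qed.

(** The only generators whose images are not prescribed directly are the permutations
    other than simple transpositions; the Coxeter presentation supplies these. *)
Lemma hecke_to_spin : exists2 Phi : Hc -> T, superalg_hom Phi &
  [/\ forall i, Phi (d i) = tens_c i,
      forall i, Phi (a i) = r ∙ (tens_c i * tens_b i) &
      forall i, Phi (S i) = r^-1 ∙ (clifford_diff tens_c i * tens_t i)].
Proof.
have tc i k : tens_t i * tens_c k = - (tens_c k * tens_t i) by exact: tens_spin_c.
have bc i k : tens_b i * tens_c k = - (tens_c k * tens_b i) by exact: tens_spin_c.
have s_c := hecke_s_c r tens_c_sq tens_c_anti tc.
have [f [f1 fM fs]] := coxeter_presentation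
  (hecke_s_sq r_sq nz2 tens_c_sq tens_c_anti tens_t_sq tc)
  (hecke_s_braid r tens_c_sq tens_c_anti tens_t_braid tc)
  (hecke_s_comm r tens_c_sq tens_c_anti tens_t_anti tc).
pose phi (x : hc_gen n) : T := match x with
  | inl (inl i) => hecke_a r tens_c tens_b i
  | inl (inr i) => tens_c i
  | inr w => f w
  end.
have phi_gen x : free_eval phi (fgen K x) = phi x by exact: free_eval_gen.
(* By multiplicativity this reduces to simple transpositions. *)
have f_c w i : f w * tens_c i = tens_c (w i) * f w.
  move: i; elim/perm_simple_ind: w => [|j w IH] i.
    by rewrite f1 perm1 mul1r mulr1.
  by rewrite fM fs -mulrA s_c (mulrA (f w) (tens_c _)) IH permM (mulrA (tens_c _) (f w)).
have tens_c_odd i : homogeneous true (tens_c i).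
  exact: homogeneous_tens (Cl_c_homogeneous i) (homogeneous1 _).
have tens_spin_odd x : homogeneous true (1 ⊗ Hm_gen K x : T).
  exact: homogeneous_tens (homogeneous1 _) (Hm_gen_homogeneous x).
have [||Phi hPhi PhiE] := @presalg_universal K
    (Presentation (@hc_homogeneous K n)) T phi.
- case=> [[i|i]|w] /=.
  + apply: homogeneousZ; exact: (homogeneousM (tens_c_odd i) (tens_spin_odd (hm_gb i))).
  + exact: tens_c_odd.
  + elim/perm_simple_ind: w => [|i w IH]; first by rewrite f1; exact: homogeneous1.
    rewrite fM fs; apply: (homogeneousM (a := false) (b := false)) => //.
    apply: homogeneousZ; apply: (homogeneousM (a := true) (b := true)) (tens_spin_odd (hm_gt i)).
    exact: homogeneousD (tens_c_odd _) (homogeneousN (tens_c_odd _)).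
- move=> l r' /=; case=> [|u w|w i|i|i j ne|i j jl jh|i|i|i j|i j ne].
  + apply: (eq_through (phi_gen _) e1).
    exact: f1.
  + apply: (eq_through (phi_gen _ ** phi_gen _) (phi_gen _)).
    exact: esym (fM w u).
  + apply: (eq_through (phi_gen _ ** phi_gen _) (phi_gen _ ** phi_gen _)).
    exact: (f_c w i).
  + apply: (eq_through (phi_gen _ ** phi_gen _) e1).
    exact: (tens_c_sq i).
  + apply: (eq_through (phi_gen _ ** phi_gen _) (opp (phi_gen _ ** phi_gen _))).
    exact: (tens_c_anti ne).
  + apply: (eq_through (phi_gen _ ** phi_gen _) (phi_gen _ ** phi_gen _)); rewrite /= fs.
    exact: (hecke_as r tens_c_sq tens_c_anti tens_t_b bc tc jl jh).
  + apply: (eq_through (add (phi_gen _ ** phi_gen _) (opp (phi_gen _ ** phi_gen _)))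
        (add e1 (opp (phi_gen _ ** phi_gen _)))); rewrite /= fs.
    exact: (hecke_affine r_sq nz2 tens_c_sq tens_c_anti tens_affine bc tc i).
  + apply: (eq_through (phi_gen _ ** phi_gen _) (opp (phi_gen _ ** phi_gen _))).
    exact: (hecke_ca r bc i).
  + apply: (eq_through (phi_gen _ ** phi_gen _) (phi_gen _ ** phi_gen _)).
    exact: (hecke_aa r tens_c_anti tens_b_anti bc i j).
  + apply: (eq_through (phi_gen _ ** phi_gen _) (phi_gen _ ** phi_gen _)).
    exact: (hecke_ca_comm r tens_c_anti bc ne).
exists Phi => //; split=> i.
- exact: PhiE (hc_gc i).
- exact: PhiE (hc_ga i).
- by rewrite [LHS](PhiE (hc_gs _)) /= fs.
Qed.

(** The universal property of the tensor product is applied to the two homomorphisms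
    that send the Clifford algebra and the spin algebra to the Hecke-Clifford
    algebra; they obey the sign rule because their generators anticommute. *)
Lemma spin_to_hecke : exists2 Psi : T -> Hc, superalg_hom Psi &
  [/\ forall i, Psi (tens_c i) = d i,
      forall i, Psi (tens_b i) = r^-1 ∙ (d i * a i) &
      forall i, Psi (tens_t i) = r^-1 ∙ ((d (ord_hi i) - d (ord_lo i)) * S i)].
Proof.
have S_c (i : 'I_n.-1) k : S i * d k = d (s i k) * S i :> Hc by exact: Hc_sigma_c.
have Hc_gen_hom x : homogeneous (hc_par x) (Hc_gen K x : Hc).
  exact: (presalg_gen_homogeneous (p := Presentation (@hc_homogeneous K n))).
have d_odd i : homogeneous true (d i : Hc) by exact: Hc_gen_hom (hc_gc i).
have d_gen (x : 'I_n) : free_eval (@Hc_c K n) (fgen K x) = d x by exact: free_eval_gen.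
have [||al hal alE] := @presalg_universal K
    (Presentation (@clifford_homogeneous K n)) Hc (@Hc_c K n).
- exact: d_odd.
- move=> l r' /=; case=> [i|i j ne].
    apply: (eq_through (d_gen _ ** d_gen _) e1).
    exact: (Hc_c_sq i).
  apply: (eq_through (d_gen _ ** d_gen _) (opp (d_gen _ ** d_gen _))).
  exact: (Hc_c_anti ne).
pose psi (x : hm_gen n) : Hc := match x with
  | inl i => spin_b r (@Hc_c K n) (@Hc_a K n) i
  | inr i => spin_t r (@Hc_c K n) (@Hc_s K n) i
  end.
have psi_gen x : free_eval psi (fgen K x) = psi x by exact: free_eval_gen.
have [||be hbe beE] := @presalg_universal K
    (Presentation (@hm_homogeneous K n)) Hc psi.
- case=> i /=; apply: homogeneousZ.
  + exact: homogeneousM (d_odd i) (Hc_gen_hom (hc_ga i)).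
  + have D_odd := homogeneousD (d_odd (ord_hi i)) (homogeneousN (d_odd (ord_lo i))).
    exact: (homogeneousM D_odd (Hc_gen_hom (hc_gs (s i)))).
- move=> l r' /=; case=> [i|i j e|i j far|i j ne|i|j i il ih].
  + apply: (eq_through (psi_gen _ ** psi_gen _) e1).
    exact: (spin_t_sq r_sq nz2 Hc_c_sq Hc_c_anti Hc_s_sq S_c i).
  + apply: (eq_through (psi_gen _ ** psi_gen _ ** psi_gen _) (psi_gen _ ** psi_gen _ ** psi_gen _)).
    exact: (spin_t_braid r Hc_c_sq Hc_c_anti Hc_s_braid S_c e).
  + apply: (eq_through (psi_gen _ ** psi_gen _) (opp (psi_gen _ ** psi_gen _))) => /=.
    have anti := spin_t_anti r Hc_c_sq Hc_c_anti Hc_s_comm S_c.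
    case/orP: far => lt; first exact: anti.
    by rewrite (anti _ _ lt) opprK.
  + apply: (eq_through (psi_gen _ ** psi_gen _) (opp (psi_gen _ ** psi_gen _))).
    exact: (spin_b_anti r Hc_c_anti Hc_a_a Hc_c_a_comm ne).
  + apply: (eq_through (psi_gen _ ** psi_gen _) (add (opp (psi_gen _ ** psi_gen _)) e1)).
    exact: (spin_affine r_sq nz2 Hc_c_sq Hc_c_anti S_c Hc_affine Hc_c_a Hc_c_a_comm i).
  + apply: (eq_through (psi_gen _ ** psi_gen _) (opp (psi_gen _ ** psi_gen _))).
    exact: (spin_tb_anti r Hc_c_sq Hc_c_anti S_c Hc_a_s Hc_c_a_comm il ih).
have sc : supercommute al be.
  apply: presalg_supercommute => // i x; rewrite alE beE expr1 mulN1r.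
  case: x => x.
  - exact: (spin_bc r Hc_c_sq Hc_c_anti Hc_c_a Hc_c_a_comm x i).
  - exact: (spin_tc r Hc_c_sq Hc_c_anti S_c x i).
have [Psi [hPsi Pal Pbe]] := tensor_universal hal hbe sc.
exists Psi => //; split=> i.
- by rewrite [LHS]Pal [LHS]alE.
- by rewrite [LHS]Pbe [LHS](beE (hm_gb i)).
- by rewrite [LHS]Pbe [LHS](beE (hm_gt i)).
Qed.

(** Over any field of characteristic different from 2 with a square root r of - 2. Both
    composites are homomorphisms, so they are compared with the identity on
    generators. *)
Theorem hecke_spin_iso : exists (Phi : Hc -> T) (Psi : T -> Hc),
    [/\ superalg_hom Phi, superalg_hom Psi, cancel Phi Psi & cancel Psi Phi]
    /\
    [/\ forall i, Phi (d i) = c i ⊗ 1,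
        forall i, Phi (a i) = r ∙ (c i ⊗ b i) &
        forall i, Phi (S i) = r^-1 ∙ ((c (ord_lo i) - c (ord_hi i)) ⊗ t i)]
    /\
    [/\ forall i, Psi (c i ⊗ 1) = d i,
        forall i, Psi (1 ⊗ b i) = r^-1 ∙ (d i * a i) &
        forall i, Psi (1 ⊗ t i) = r^-1 ∙ ((d (ord_hi i) - d (ord_lo i)) * S i)].
Proof.
have [Phi hPhi [Phi_c Phi_a Phi_s]] := hecke_to_spin.
have [Psi hPsi [Psi_c Psi_b Psi_t]] := spin_to_hecke.
have r0 := sqrtN2_neq0 r_sq nz2.
have hPsiPhi := superalg_hom_comp hPhi hPsi.
have hPhiPsi := superalg_hom_comp hPsi hPhi.
have PsiPhi_s i : Psi (Phi (S i)) = S i.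
  rewrite Phi_s (superalg_homZ hPsi) (superalg_homM hPsi) (superalg_homB hPsi).
  rewrite !Psi_c Psi_t.
  exact: (clifford_diff_cancel r_sq nz2 Hc_c_sq Hc_c_anti).
exists Phi, Psi; split; last split; last by split.
- split=> //.
  + apply: (presalg_hom_ext hPsiPhi (superalg_hom_id _)) => -[[i|i]|w] /=.
    * rewrite [Phi _]Phi_a (superalg_homZ hPsi) (superalg_homM hPsi) Psi_c Psi_b.
      exact: (clifford_scale_cancel Hc_c_sq _ _ (mulfV r0)).
    * by rewrite [Phi _]Phi_c [LHS]Psi_c.
    * rewrite -[presalg_gen _]/(sg w).
      elim/perm_simple_ind: w => [|i w IH].
        by rewrite Hc_sigma_1 (superalg_hom1 hPhi) (superalg_hom1 hPsi).
      by rewrite Hc_sigma_mul (superalg_homM hPhi) (superalg_homM hPsi) IH PsiPhi_s.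
  + apply: (tensor_hom_ext hPhiPsi (superalg_hom_id _)) => [x|y] /=.
    * move: x; apply: (presalg_hom_ext (superalg_hom_comp (tens_inl_hom _ _) hPhiPsi)
        (tens_inl_hom _ _)) => i /=.
      by rewrite [Psi _]Psi_c [LHS]Phi_c.
    * move: y; apply: (presalg_hom_ext (superalg_hom_comp (tens_inr_hom _ _) hPhiPsi)
        (tens_inr_hom _ _)) => -[i|i] /=.
        rewrite [Psi _]Psi_b (superalg_homZ hPhi) (superalg_homM hPhi) Phi_c Phi_a.
        exact: (clifford_scale_cancel tens_c_sq _ _ (mulVf r0)).
      rewrite [Psi _]Psi_t (superalg_homZ hPhi) (superalg_homM hPhi) (superalg_homB hPhi).
      rewrite !Phi_c Phi_s.
      exact: (clifford_diffN_cancel r_sq nz2 tens_c_sq tens_c_anti).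
- split=> i.
  + exact: Phi_c.
  + by rewrite Phi_a -tens_factor.
  + by rewrite Phi_s tens_factor tensDl tensNl.
Qed.

End Isomorphism.

Theorem theorem4p1 (R : realType) (r : R[i]) (hr : r ^+ 2 = - 2)
    (n : nat) (hn : (0 < n)%N) :
  let C : fieldType := R[i] in
  exists (Phi : hecke_clifford C n -> tensor (clifford C n) (spin_hecke C n))
         (Psi : tensor (clifford C n) (spin_hecke C n) -> hecke_clifford C n),
    [/\ superalg_hom Phi, superalg_hom Psi, cancel Phi Psi & cancel Psi Phi]
    /\
    [/\ forall i, Phi (Hc_c C i) = Cl_c C i ⊗ 1,
        forall i, Phi (Hc_a C i) = r ∙ (Cl_c C i ⊗ Hm_b C i) &
        forall i, Phi (Hc_s C i)
          = r^-1 ∙ ((Cl_c C (ord_lo i) - Cl_c C (ord_hi i)) ⊗ Hm_t C i)]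
    /\
    [/\ forall i, Psi (Cl_c C i ⊗ 1) = Hc_c C i,
        forall i, Psi (1 ⊗ Hm_b C i) = r^-1 ∙ (Hc_c C i * Hc_a C i) &
        forall i, Psi (1 ⊗ Hm_t C i)
          = r^-1 ∙ ((Hc_c C (ord_hi i) - Hc_c C (ord_lo i)) * Hc_s C i)].
Proof.
move=> C; apply: (@hecke_spin_iso C r n hr).
by rewrite Num.Theory.pnatr_eq0.
Qed.
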